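(* Let $\{x^k\}_{k\in\mathbb{N}}$ be the infinite sequence generated by HpgSRN (described in the context) for the problem $\min_{x\in\mathbb{R}^n}F(x)=f(Ax)+\lambda\|x\|_q^q$. Suppose that $\nabla^2 f$ is locally Lipschitz continuous on $\mathbb{R}^m$ and that $$\liminf_{\mathcal{K}_2\ni k\to\infty}\frac{-\langle r^k,d^k_{S_k}\rangle}{\|r^k\|\,\|d^k_{S_k}\|}>0 .$$ Then the following assertions hold. (i) If $F$ is a KL function, then $\sum_{k=1}^\infty\|x^{k+1}-x^k\|<\infty$, and consequently $\{x^k\}_{k\in\mathbb{N}}$ converges to an $L$-type stationary point of the problem, say $x^*$. (ii) If, moreover, $F$ has the KL property of exponent $1/2$ at $x^*$, then $\{x^k\}_{k\in\mathbb{N}}$ converges $R$-linearly to $x^*$.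
   Context: Problem data. $A\in\mathbb{R}^{m\times n}$; $f:\mathbb{R}^m\to\mathbb{R}$ is twice continuously differentiable with $c_f:=\inf_{z}f(z)>-\infty$; $\lambda>0$; $0<q<1$. Write $\psi(x):=f(Ax)$, $g(x):=\|x\|_q^q=\sum_{i=1}^n|x_i|^q$, $F:=\psi+\lambda g$. For $S\subseteq\{1,\dots,n\}$, $x_S\in\mathbb{R}^{|S|}$ is the subvector of $x$ indexed by $S$, $A_S$ the submatrix of columns of $A$ indexed by $S$, $S^c$ the complement, and $F_S(u):=f(A_Su)+\lambda\sum_{i\in S}|u_i|^q$ for $u\in\mathbb{R}^{|S|}$ (twice continuously differentiable at points with all entries nonzero). $\mathrm{supp}(x):=\{i: x_i\neq0\}$; $\mathrm{sign}(x)$ is taken componentwise; $|x|_{\min}:=\min_{i\in\mathrm{supp}(x)}|x_i|$; $a_+:=\max\{a,0\}$; $\lambda_{\min}(\cdot)$ is the smallest eigenvalue. $\mathrm{prox}_{\mu^{-1}(\lambda g)}(y):=\arg\min_z\{\frac{\mu}{2}\|z-y\|^2+\lambda g(z)\}$ (a set). $x$ is an $L$-type stationary point if there is $\mu>0$ with $x\in\mathrm{prox}_{\mu^{-1}(\lambda g)}(x-\mu^{-1}\nabla\psi(x))$. KL property. $\partial$ denotes the limiting (Mordukhovich) subdifferential. A proper function $h:\mathbb{R}^n\to(-\infty,\infty]$ has the KL property at $\overline{x}\in\mathrm{dom}\,\partial h$ if there are $\eta\in(0,\infty]$, a neighborhood $\mathcal{U}$ of $\overline{x}$ and a continuous concave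 $\varphi:[0,\eta)\to\mathbb{R}_+$ with $\varphi(0)=0$, $\varphi$ continuously differentiable on $(0,\eta)$ with $\varphi'>0$ there, such that $\varphi'(h(x)-h(\overline{x}))\,\mathrm{dist}(0,\partial h(x))\ge1$ for all $x\in\mathcal{U}$ with $h(\overline{x})<h(x)<h(\overline{x})+\eta$. If $\varphi$ can be chosen as $\varphi(s)=c\sqrt{s}$ with $c>0$, $h$ has the KL property of exponent $1/2$ at $\overline{x}$. $h$ is a KL function if it has the KL property at every point of $\mathrm{dom}\,\partial h$. Proximal gradient step $\mathcal{G}$. Given $x$, $\mu>0$, $\widetilde\tau>1$, $\widetilde\alpha>0$: for $l=0,1,\dots$ put $\mu_l=\widetilde\tau^{\,l}\mu$ and pick $x^l\in\mathrm{prox}_{\mu_l^{-1}(\lambda g)}(x-\mu_l^{-1}\nabla\psi(x))$; stop at the first $l$ with $F(x^l)\le F(x)-\frac{\widetilde\alpha}{2}\|x^l-x\|^2$ and return $[x^l,\mu_l]$. HpgSRN. Parameters $\widetilde\tau>1$, $\widetilde\alpha>0$, $\mu_{\max}>\mu_{\min}>0$, $\sigma\in(0,\frac12]$, $\varrho\in(0,\frac12)$, $\beta\in(0,1)$, $b_1>1$, $b_2>0$; initial point $x^0\in\mathbb{R}^n$; tolerance $\epsilon=0$. At iteration $k=0,1,2,\dots$: Step 1: choose $\mu_k\in[\mu_{\min},\mu_{\max}]$ and set $[\overline{x}^k,\overline\mu_k]=\mathcal{G}(x^k,\mu_k)$. If $\overline\mu_k\|x^k-\overline{x}^k\|_\infty\le\epsilon$,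 stop. Let $\overline\omega_k=\overline\mu_k+\lambda q(q-1)|\overline{x}^k|_{\min}^{q-2}$. If $\mathrm{sign}(x^k)=\mathrm{sign}(\overline{x}^k)$ and $\overline\mu_k+\lambda q(q-1)|x^k|_{\min}^{q-2}\ge\frac12\overline\omega_k$, go to Step 2; otherwise set $x^{k+1}=\overline{x}^k$ and go to the next iteration. Step 2: let $S_k=\mathrm{supp}(x^k)$, $u^k=x^k_{S_k}$, $r^k=\nabla F_{S_k}(u^k)$, $\zeta_k=[-\lambda_{\min}(\nabla^2F_{S_k}(u^k))]_+$, $G^k=\nabla^2F_{S_k}(u^k)+(b_1\zeta_k+b_2\|r^k\|^\sigma)I$. Let $d^k_{S_k}$ be the solution of $G^kd=-r^k$ and $d^k_{S_k^c}=0$. Let $m_k$ be the smallest nonnegative integer $m$ with $F_{S_k}(u^k+\beta^md^k_{S_k})\le F_{S_k}(u^k)+\varrho\beta^m\langle r^k,d^k_{S_k}\rangle$; set $\alpha_k=\beta^{m_k}$, $x^{k+1}=x^k+\alpha_kd^k$, and go to the next iteration. $\mathcal{K}_1$ is the set of $k$ for which $x^{k+1}$ is generated by Step 1, and $\mathcal{K}_2=\mathbb{N}\setminus\mathcal{K}_1$. Standing assumption: the algorithm does not stop, i.e. $x^k\neq\overline{x}^k$ for all $k$, so the sequence is infinite. (If $\overline{x}^k=0$ the sign condition then fails, so $|0|_{\min}$ is never needed.) *)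

(* Defs.v *)
From HB Require Import structures.
From mathcomp Require Import all_boot all_order all_algebra.
From mathcomp Require Import all_classical all_reals all_analysis.

Set Implicit Arguments.
Unset Strict Implicit.
Unset Printing Implicit Defensive.

Import Order.TTheory GRing.Theory Num.Theory.
Import numFieldNormedType.Exports.

Local Open Scope classical_set_scope.
Local Open Scope ring_scope.

(* The library norm `|x| on matrices is the sup norm; it induces the usual
   topology of R^n.  Euclidean quantities are therefore introduced here. *)
Section Euclidean.
Context {R : realType}.
Implicit Types n : nat.

Definition dot n (u v : 'cV[R]_n) : R := \sum_i u i 0 * v i 0.

Definition enorm n (u : 'cV[R]_n) : R := Num.sqrt (dot u u).

End Euclidean.

Section Calculus.
Context {R : realType}.

Definition grad n (h : 'cV[R]_n -> R) (x : 'cV[R]_n) : 'cV[R]_n :=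
  \col_i 'D_(delta_mx i 0) h x.

Definition hess n (h : 'cV[R]_n -> R) (x : 'cV[R]_n) : 'M[R]_n :=
  \matrix_(i, j) 'D_(delta_mx j 0) (fun y => grad h y i 0) x.

Definition twice_continuously_differentiable n (h : 'cV[R]_n -> R) : Prop :=
  [/\ forall x, differentiable h x,
      forall x, differentiable (grad h) x
    & continuous (hess h)].

Definition locally_lipschitz n p r (h : 'cV[R]_n -> 'M[R]_(p, r)) : Prop :=
  forall x : 'cV[R]_n, exists2 U : set 'cV[R]_n, nbhs x U & [lipschitz h y | y in U].

(* Only used for symmetric M of positive size, whose set of real eigenvalues
   is finite and nonempty, so that the infimum is a minimum. *)
Definition lambda_min n (M : 'M[R]_n) : R := inf [set a | eigenvalue M a].

End Calculus.

Section KurdykaLojasiewicz.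
Context {R : realType} {n : nat}.
Implicit Types (h : 'cV[R]_n -> \bar R) (x v : 'cV[R]_n).

(* Regular (Frechet) subdifferential:
   h y >= h x + <v, y - x> + o(|y - x|) as y tends to x. *)
Definition regular_subdiff h x : set 'cV[R]_n :=
  [set v | h x \is a fin_num /\
     forall e : R, 0 < e ->
       \forall y \near x,
         (h x + (dot v (y - x) - e * enorm (y - x))%:E <= h y)%E].

Definition limiting_subdiff h x : set 'cV[R]_n :=
  [set v | h x \is a fin_num /\
     exists xs vs : nat -> 'cV[R]_n,
       [/\ xs @ \oo --> x,
           (fun j => h (xs j)) @ \oo --> h x,
           forall j, regular_subdiff h (xs j) (vs j)
         & vs @ \oo --> v]].

Definition dom_subdiff h : set 'cV[R]_n :=
  [set x | limiting_subdiff h x !=set0].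

(* dist(0, subdifferential), equal to +oo when the subdifferential is empty *)
Definition dist0_subdiff h x : \bar R :=
  ereal_inf [set (enorm v)%:E | v in limiting_subdiff h x].

Definition desingularizing (eta : \bar R) (phi : R -> R) : Prop :=
  let D := [set s : R | 0 <= s /\ (s%:E < eta)%E] in
  let D' := [set s : R | 0 < s /\ (s%:E < eta)%E] in
  [/\ {within D, continuous phi} /\ (forall s, D s -> 0 <= phi s),
      forall s t a : R, D s -> D t -> 0 <= a <= 1 ->
        a * phi s + (1 - a) * phi t <= phi (a * s + (1 - a) * t),
      phi 0 = 0,
      forall s, D' s -> derivable phi s 1 /\ {for s, continuous (derive1 phi)}
    & forall s, D' s -> 0 < derive1 phi s].

Definition KL_with h (xb : 'cV[R]_n) (phi : R -> R) : Prop :=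
  dom_subdiff h xb /\
  exists eta : \bar R, exists U : set 'cV[R]_n,
    [/\ (0 < eta)%E, nbhs xb U, desingularizing eta phi
      & forall x, U x -> (h xb < h x)%E -> (h x < h xb + eta)%E ->
          (1 <= (derive1 phi (fine (h x - h xb)))%:E * dist0_subdiff h x)%E].

Definition KL_at h xb : Prop := exists phi : R -> R, KL_with h xb phi.

Definition KL_exponent_half_at h xb : Prop :=
  exists2 c : R, 0 < c & KL_with h xb (fun s => c * Num.sqrt s).

Definition KL_function h : Prop := forall x, dom_subdiff h x -> KL_at h x.

End KurdykaLojasiewicz.

Section Vectors.
Context {R : realType} {n : nat}.
Implicit Types (x : 'cV[R]_n) (S : {set 'I_n}).

Definition supp x : {set 'I_n} := [set i | x i 0 != 0].

Definition sign x : 'cV[R]_n := map_mx Num.sg x.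

(* The sup norm `|x| bounds every entry, so for x != 0 this is the minimum
   over the support. *)
Definition absmin x : R := \big[Num.min/`|x|]_(i in supp x) `|x i 0|.

Definition subvec S x : 'cV[R]_#|S| := rowsub enum_val x.

Definition subcols m S (A : 'M[R]_(m, n)) : 'M[R]_(m, #|S|) :=
  colsub enum_val A.

Definition r_linear_cvg (x : nat -> 'cV[R]_n) (xs : 'cV[R]_n) : Prop :=
  exists c rho : R, [/\ 0 < c, 0 < rho < 1
    & forall k, enorm (x k - xs) <= c * rho ^+ k].

End Vectors.

Section Problem.
Context {R : realType} {m : nat}.
Variables (f : 'cV[R]_m -> R) (lambda q : R).

Definition lq n (x : 'cV[R]_n) : R := \sum_i `|x i 0| `^ q.

Definition psi n (A : 'M[R]_(m, n)) (x : 'cV[R]_n) : R := f (A *m x).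

Definition F n (A : 'M[R]_(m, n)) (x : 'cV[R]_n) : R :=
  psi A x + lambda * lq x.

Definition FS n (A : 'M[R]_(m, n)) (S : {set 'I_n}) : 'cV[R]_#|S| -> R :=
  F (subcols S A).

(* prox of mu^-1 (lambda g) at y *)
Definition prox n (mu : R) (y : 'cV[R]_n) : set 'cV[R]_n :=
  [set z | forall w, mu / 2 * enorm (z - y) ^+ 2 + lambda * lq z
                  <= mu / 2 * enorm (w - y) ^+ 2 + lambda * lq w].

Definition prox_grad n (A : 'M[R]_(m, n)) (mu : R) (x : 'cV[R]_n) :
    set 'cV[R]_n :=
  prox mu (x - mu^-1 *: grad (psi A) x).

Definition L_stationary n (A : 'M[R]_(m, n)) (x : 'cV[R]_n) : Prop :=
  exists2 mu : R, 0 < mu & prox_grad A mu x x.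

(* [xb, mub] is a possible output of the backtracking proximal gradient step
   from x and mu; y lists the trial points. *)
Definition prox_step n (A : 'M[R]_(m, n)) (tau alpha : R)
    (x : 'cV[R]_n) (mu : R) (xb : 'cV[R]_n) (mub : R) : Prop :=
  let accept z := F A z <= F A x - alpha / 2 * enorm (z - x) ^+ 2 in
  exists (l : nat) (y : nat -> 'cV[R]_n),
    [/\ forall j, (j <= l)%N -> prox_grad A (tau ^+ j * mu) x (y j),
        forall j, (j < l)%N -> ~~ accept (y j),
        accept (y l)
      & xb = y l /\ mub = tau ^+ l * mu].

Definition curvature n (mu : R) (x : 'cV[R]_n) : R :=
  mu + lambda * q * (q - 1) * absmin x `^ (q - 2).

Definition newton_test n (x xb : 'cV[R]_n) (mub : R) : bool :=
  (sign x == sign xb) && (curvature mub xb / 2 <= curvature mub x).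

Definition rvec n (A : 'M[R]_(m, n)) (x : 'cV[R]_n) : 'cV[R]_#|supp x| :=
  grad (FS A (S := supp x)) (subvec (supp x) x).

Definition Hmat n (A : 'M[R]_(m, n)) (x : 'cV[R]_n) : 'M[R]_#|supp x| :=
  hess (FS A (S := supp x)) (subvec (supp x) x).

Definition zeta n (A : 'M[R]_(m, n)) (x : 'cV[R]_n) : R :=
  Num.max (- lambda_min (Hmat A x)) 0.

Definition Gmat n (A : 'M[R]_(m, n)) (sigma b1 b2 : R) (x : 'cV[R]_n) :
    'M[R]_#|supp x| :=
  Hmat A x + (b1 * zeta A x + b2 * enorm (rvec A x) `^ sigma)%:M.

Definition armijo n (A : 'M[R]_(m, n)) (varrho beta : R)
    (x d : 'cV[R]_n) (j : nat) : bool :=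
  let S := supp x in
  FS A (subvec S x + beta ^+ j *: subvec S d)
    <= FS A (subvec S x) + varrho * beta ^+ j * dot (rvec A x) (subvec S d).

(* Step from x to x' along the direction d *)
Definition newton_step n (A : 'M[R]_(m, n)) (sigma varrho beta b1 b2 : R)
    (x d x' : 'cV[R]_n) : Prop :=
  [/\ Gmat A sigma b1 b2 x *m subvec (supp x) d = - rvec A x,
      forall i, i \notin supp x -> d i 0 = 0
    & exists j : nat,
        [/\ armijo A varrho beta x d j,
            forall i, (i < j)%N -> ~~ armijo A varrho beta x d i
          & x' = x + beta ^+ j *: d]].

(* An infinite run with tolerance eps: the stopping test fails at every k.
   The value d k is constrained only at the iterations that reach Step 2. *)
Definition hpgsrn_run n (A : 'M[R]_(m, n))
    (tau alpha mu_min mu_max sigma varrho beta b1 b2 eps : R)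
    (x xb d : nat -> 'cV[R]_n) (mu mub : nat -> R) : Prop :=
  forall k,
    [/\ mu_min <= mu k <= mu_max,
        prox_step A tau alpha (x k) (mu k) (xb k) (mub k),
        ~~ (mub k * `|x k - xb k| <= eps)
      & if newton_test (x k) (xb k) (mub k)
        then newton_step A sigma varrho beta b1 b2 (x k) (d k) (x k.+1)
        else x k.+1 = xb k].

Definition K2 n (x xb : nat -> 'cV[R]_n) (mub : nat -> R) : set nat :=
  [set k | newton_test (x k) (xb k) (mub k)].

Definition descent_cosine n (A : 'M[R]_(m, n)) (x d : 'cV[R]_n) : R :=
  - dot (rvec A x) (subvec (supp x) d)
    / (enorm (rvec A x) * enorm (subvec (supp x) d)).

End Problem.

(* Main.v *)
Require Import Defs.
From mathcomp Require Import all_boot all_order all_algebra.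
From mathcomp Require Import all_classical all_reals all_analysis.
From mathcomp Require Import ring lra.

Set Implicit Arguments.
Unset Strict Implicit.
Unset Printing Implicit Defensive.

Import Order.TTheory GRing.Theory Num.Theory.
Import numFieldNormedType.Exports.

Local Open Scope classical_set_scope.
Local Open Scope ring_scope.

(* F decreases along the run, so the iterates stay bounded and the backtracked
   parameters mub_k stay bounded above; comparing a prox point with its scalings
   bounds its nonzero entries away from 0.  At a Newton iteration the curvature
   test makes the proximal subproblem strongly convex between x_k and xb_k, so
   the residual r_k dominates x_k - xb_k, while the angle condition and Armijo
   backtracking give F(x_(k+1)) <= F(x_k) - kappa |r_k| |x_(k+1) - x_k| with
   |x_(k+1) - x_k| >= min(a, b |r_k|).  Hence x_k - xb_k -> 0.  Eventually
   supp x_(k+1) <= supp xb_k <= supp x_k, so the supports stabilise, the test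
   always passes, and only Newton steps remain.  As r_k extended by 0 is a
   subgradient of F at x_k, the KL inequality turns the decrease into
   phi(e_k) - phi(e_(k+1)) >= kappa |x_(k+1) - x_k| with e_k = F(x_k) - lim F,
   and telescoping concludes.  For phi = c sqrt it gives
   e_(k+1) <= (1 - theta) e_k. *)

(** * Tangent-line inequalities for real powers *)

Section RealPowers.
Context {R : realType}.
Implicit Types (a b p q s t : R).

(** The penalty has infinite slope at 0, so smooth estimates hold only on a fixed support with
    entries bounded away from zero. Two facts about t^q make up for this. On a half-line it lies
    below its tangents, so a descent lemma needs a quadratic term from f alone. And comparing a prox
    point with 0, besides stationarity, leaves it a curvature of at least mu (1 - q/2); the Newton
    test hands half of this margin to x_k.

    In min(a, b |r_k|), a covers a rejected trial step long enough to change a sign; b covers an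
    accepted full step, through an upper bound on the regularised Hessian, and a short rejected
    trial, through the failed Armijo test.

    The decrease is a product |r_k| |x_(k+1) - x_k| with the residual taken at x_k, the very point
    where KL is applied. A tangent bound for phi then suffices, and no subgradient estimate at
    x_(k+1) enters.

    KL is local, while at first only a cluster point is known, so convergence has to come out of a
    trapping argument. KL also speaks only of values above the limit value; the strict decrease of
    Newton steps provides this. *)

Lemma powR_ge_tangent1 p s : p <= 0 -> 0 < s -> 1 + p * (s - 1) <= s `^ p.
Proof.
move=> p0 s0; rewrite /powR gt_eqF//.
have lns : ln s <= s - 1 by have := @le_ln1Dx R (s - 1); rewrite subrKC; apply; lra.
apply: le_trans (expR_ge1Dx (p * ln s)).
by rewrite lerD2l; apply: ler_wnM2l.
Qed.

(** Weighted arithmetic-geometric mean inequality for s and 1. Both are written as multiples of E =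
    s^q; after exp t >= 1 + t is applied to the two factors, the terms in [ln s] cancel. *)
Lemma powR_le_tangent1 q s : 0 < q < 1 -> 0 <= s -> s `^ q <= 1 + q * (s - 1).
Proof.
move=> /andP[q0 q1]; rewrite le_eqVlt => /predU1P[<-|s0].
  by rewrite powR0 ?gt_eqF//; lra.
rewrite /powR gt_eqF//; set E := expR _.
have E0 : 0 < E by apply: expR_gt0.
have sE : s = E * expR ((1 - q) * ln s).
  by rewrite -expRD mulrBl mul1r addrC subrK lnK.
have oneE : 1 = E * expR (- (q * ln s)) by rewrite -expRD subrr expR0.
have h1 := expR_ge1Dx ((1 - q) * ln s).
have h2 := expR_ge1Dx (- (q * ln s)).
have : E <= q * s + (1 - q) * 1; last by lra.
rewrite [in X in _ <= X]sE [X in _ <= _ + _ * X]oneE.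
have -> : q * (E * expR ((1 - q) * ln s)) + (1 - q) * (E * expR (- (q * ln s)))
  = E * (q * expR ((1 - q) * ln s) + (1 - q) * expR (- (q * ln s))) by ring.
rewrite -[leLHS]mulr1; apply: ler_wpM2l; first exact: ltW.
apply: le_trans (lerD (ler_wpM2l (ltW q0) h1) (ler_wpM2l _ h2)); last by lra.
by rewrite le_eqVlt; apply/orP; left; apply/eqP; ring.
Qed.

Lemma powR_pred a p : 0 < a -> a `^ p = a `^ (p - 1) * a.
Proof.
move=> a0; have <- : a `^ (p - 1) * a `^ 1 = a `^ p.
  by rewrite -powRD ?subrK//; apply/implyP => _; rewrite gt_eqF.
by rewrite powRr1 ?ltW.
Qed.

Lemma powR_le_tangent q a b : 0 < q < 1 -> 0 < a -> 0 <= b ->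
  b `^ q <= a `^ q + q * a `^ (q - 1) * (b - a).
Proof.
move=> q01 a0 b0.
have -> : b `^ q = a `^ q * (b / a) `^ q.
  by rewrite -powRM ?(divr_ge0 b0) ?(ltW a0)//; congr powR; field; rewrite gt_eqF.
have -> : a `^ q + q * a `^ (q - 1) * (b - a) = a `^ q * (1 + q * (b / a - 1)).
  by rewrite [a `^ q]powR_pred//; field; rewrite gt_eqF.
by apply: ler_wpM2l; rewrite ?powR_ge0// powR_le_tangent1 ?(divr_ge0 b0 (ltW a0)).
Qed.

Lemma powR_ge_tangent p a b : p <= 0 -> 0 < a -> 0 < b ->
  a `^ p + p * a `^ (p - 1) * (b - a) <= b `^ p.
Proof.
move=> p0 a0 b0.
have -> : b `^ p = a `^ p * (b / a) `^ p.
  by rewrite -powRM ?ltW ?divr_gt0//; congr powR; field; rewrite gt_eqF.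
have -> : a `^ p + p * a `^ (p - 1) * (b - a) = a `^ p * (1 + p * (b / a - 1)).
  by rewrite [a `^ p]powR_pred//; field; rewrite gt_eqF.
by apply: ler_wpM2l; rewrite ?powR_ge0// powR_ge_tangent1 ?divr_gt0.
Qed.

Lemma ler_npowR p a b : p <= 0 -> 0 < a -> a <= b -> b `^ p <= a `^ p.
Proof.
move=> p0 a0 ab; have b0 := lt_le_trans a0 ab.
rewrite -[p]opprK !(powRN _ (- p)) lef_pV2 ?posrE ?powR_gt0//.
by apply: ge0_ler_powR; rewrite ?nnegrE ?oppr_ge0 // ltW.
Qed.

(** Used with p = q - 2: an upper bound on the curvature of the penalty becomes a lower bound on the
    entry. *)
Lemma npowR_le_lower_bound p a c : p < 0 -> 0 < a -> 0 < c -> a `^ p <= c -> c `^ p^-1 <= a.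
Proof.
move=> p0 a0 c0 h.
have pV0 : p^-1 <= 0 by rewrite invr_le0 ltW.
have := ler_npowR pV0 (powR_gt0 p a0) h.
by rewrite -powRrM divff ?lt_eqF// powRr1// ltW.
Qed.

End RealPowers.

(** * Euclidean and sup norms, compact balls, limits of dot products *)

Section ColumnVectors.
Context {R : realType}.
Implicit Types n m : nat.

Lemma coord_le_norm m n (M : 'M[R]_(m, n)) i j : `|M i j| <= `|M|.
Proof.
rewrite [leRHS]/Num.Def.normr/= mx_normrE.
exact: (@le_bigmax _ _ _ 0 (fun ij : 'I_m * 'I_n => `|M ij.1 ij.2|) (i, j)).
Qed.

Lemma norm_le_coord n (u : 'cV[R]_n) c :
  0 <= c -> (forall i, `|u i 0| <= c) -> `|u| <= c.
Proof.
move=> c0 uc; rewrite [leLHS]/Num.Def.normr/= mx_normrE.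
by apply: bigmax_le => //= -[i j] _ /=; rewrite (ord1 j).
Qed.

Lemma dotC n (u v : 'cV[R]_n) : dot u v = dot v u.
Proof. by apply: eq_bigr => i _; rewrite mulrC. Qed.

Lemma dotDl n (u v w : 'cV[R]_n) : dot (u + v) w = dot u w + dot v w.
Proof. by rewrite -big_split; apply: eq_bigr => i _ /=; rewrite mxE mulrDl. Qed.

Lemma dotZl n a (u v : 'cV[R]_n) : dot (a *: u) v = a * dot u v.
Proof. by rewrite mulr_sumr; apply: eq_bigr => i _; rewrite mxE mulrA. Qed.

Lemma dotNl n (u v : 'cV[R]_n) : dot (- u) v = - dot u v.
Proof. by rewrite -scaleN1r dotZl mulN1r. Qed.

Lemma dotDr n (u v w : 'cV[R]_n) : dot u (v + w) = dot u v + dot u w.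
Proof. by rewrite dotC dotDl !(dotC u). Qed.

Lemma dotZr n a (u v : 'cV[R]_n) : dot u (a *: v) = a * dot u v.
Proof. by rewrite dotC dotZl dotC. Qed.

Lemma dot_delta n (u : 'cV[R]_n) i : dot u (delta_mx i 0) = u i 0.
Proof.
rewrite /dot (bigD1 i)//= mxE !eqxx mulr1 big1 ?addr0// => j /negPf ji.
by rewrite mxE ji mulr0.
Qed.

Lemma dot_trmul m n (A : 'M[R]_(m, n)) (u : 'cV[R]_m) (v : 'cV[R]_n) :
  dot (A^T *m u) v = dot u (A *m v).
Proof.
rewrite /dot.
under eq_bigr do rewrite mxE mulr_suml.
rewrite exchange_big; apply: eq_bigr => i _ /=.
by rewrite mxE mulr_sumr; apply: eq_bigr => j _; rewrite mxE; ring.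
Qed.

Lemma dot_ge0 n (u : 'cV[R]_n) : 0 <= dot u u.
Proof. by apply: sumr_ge0 => i _; rewrite -expr2 sqr_ge0. Qed.

Lemma enorm_ge0 n (u : 'cV[R]_n) : 0 <= enorm u.
Proof. exact: sqrtr_ge0. Qed.

Lemma enorm_sqr n (u : 'cV[R]_n) : enorm u ^+ 2 = dot u u.
Proof. by rewrite sqr_sqrtr// dot_ge0. Qed.

Lemma enorm0 n : enorm (0 : 'cV[R]_n) = 0.
Proof. by rewrite /enorm /dot big1 ?sqrtr0// => i _; rewrite mxE mulr0. Qed.

Lemma enormZ n a (u : 'cV[R]_n) : enorm (a *: u) = `|a| * enorm u.
Proof.
by rewrite /enorm dotZl dotZr mulrA -expr2 sqrtrM ?sqr_ge0// sqrtr_sqr.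
Qed.

Lemma norm_le_enorm n (u : 'cV[R]_n) : `|u| <= enorm u.
Proof.
apply: norm_le_coord => [|i]; first exact: enorm_ge0.
rewrite -sqrtr_sqr ler_wsqrtr// /dot (bigD1 i)//= -expr2 lerDl.
by apply: sumr_ge0 => j _; rewrite -expr2 sqr_ge0.
Qed.

Lemma norm_dot_le n (u v : 'cV[R]_n) : `|dot u v| <= n%:R * (`|u| * `|v|).
Proof.
apply: le_trans (ler_norm_sum _ _ _) _.
apply: (@le_trans _ _ (\sum_(i < n) `|u| * `|v|)); last first.
  by rewrite sumr_const card_ord mulr_natl.
by apply: ler_sum => i _; rewrite normrM ler_pM// coord_le_norm.
Qed.

Lemma enorm_le_norm n (u : 'cV[R]_n) : enorm u <= n%:R * `|u|.
Proof.
rewrite -(@ler_pXn2r _ 2) ?nnegrE ?enorm_ge0 ?mulr_ge0// enorm_sqr.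
apply: le_trans (ler_norm _) (le_trans (norm_dot_le u u) _).
rewrite -expr2 exprMn ler_wpM2r ?sqr_ge0//.
by rewrite -natrX ler_nat; case: n u => // n u; rewrite expnS leq_pmulr ?expn_gt0.
Qed.

Lemma mulmx_norm_le m n (A : 'M[R]_(m, n)) (B : R) (u : 'cV[R]_n) :
  0 <= B -> (forall i j, `|A i j| <= B) -> `|A *m u| <= n%:R * B * `|u|.
Proof.
move=> B0 AB; apply: norm_le_coord => [|i]; first by rewrite !mulr_ge0.
rewrite mxE; apply: le_trans (ler_norm_sum _ _ _) _.
apply: (@le_trans _ _ (\sum_(i < n) B * `|u|)); last first.
  by rewrite sumr_const card_ord -mulrA [leRHS]mulr_natl.
by apply: ler_sum => j _; rewrite normrM ler_pM ?coord_le_norm.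
Qed.

(** For the sup norm the closed ball is a box, and it is obtained as the transpose of a compact box
    of row vectors. *)
Lemma cball_compact n (r : R) : compact [set v : 'cV[R]_n | `|v| <= r].
Proof.
have [r0|r0] := ltP r 0.
  rewrite (_ : mkset _ = set0); first exact: compact0.
  by apply/seteqP; split => v //= vr; have := normr_ge0 v; lra.
have trc : continuous (trmx : 'rV[R]_n -> 'cV[R]_n).
  move=> M s /= /(nbhs_ballP M^T) [e e0 es]; apply/nbhs_ballP; exists e => //=.
  by move=> N [_ MN]; apply: es; split=> // i j; rewrite !mxE; exact: MN.
rewrite (_ : mkset _ = (@trmx R 1 n) @` [set v : 'rV[R]_n | forall i, `[- r, r]%classic (v ord0 i)]).
  apply: (@continuous_compact 'rV[R]_n 'cV[R]_n).
    exact: (@continuous_subspaceT 'rV[R]_n 'cV[R]_n).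
  apply: (@rV_compact R n (fun=> `[- r, r]%classic)) => _.
  exact: segment_compact.
apply/seteqP; split => [v vr|_ [v vr <-]] /=.
  exists v^T; last by rewrite trmxK.
  move=> i /=; rewrite mxE in_itv /= -ler_norml.
  exact: le_trans (coord_le_norm _ _ _) vr.
apply: norm_le_coord => // i; rewrite mxE.
by have := vr i; rewrite /= in_itv /= -ler_norml.
Qed.

Lemma continuous_bounded_cball n (V : normedModType R) (h : 'cV[R]_n -> V) r :
  continuous h -> exists2 B, 0 <= B & forall v, `|v| <= r -> `|h v| <= B.
Proof.
move=> hc.
have /compact_bounded[M [_ hM]] : compact (h @` [set v : 'cV[R]_n | `|v| <= r]).
  apply: continuous_compact; last exact: cball_compact.
  exact: continuous_subspaceT.
exists (Num.max (M + 1) 0); first by rewrite le_max lexx orbT.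
move=> v vr; rewrite le_max; apply/orP; left.
by apply: hM; [rewrite ltrDl|exists v].
Qed.

Lemma cvg_coord n (u : nat -> 'cV[R]_n) (l : 'cV[R]_n) i :
  u @ \oo --> l -> (fun k => u k i 0) @ \oo --> l i 0.
Proof. by move=> ul; exact: (cvg_comp u (fun M : 'cV[R]_n => M i 0) ul (@coord_continuous R n 1 i 0 l)). Qed.

Lemma cvg_dot n (u v : nat -> 'cV[R]_n) (a b : 'cV[R]_n) :
  u @ \oo --> a -> v @ \oo --> b -> (fun k => dot (u k) (v k)) @ \oo --> dot a b.
Proof.
move=> ua vb; rewrite /dot; apply: cvg_big => [|i _]; last first.
  by apply: cvgM; exact: cvg_coord.
by move=> x; exact: add_continuous.
Qed.

End ColumnVectors.

(** * Mean value estimates for twice continuously differentiable functions on balls *)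

Section GradientCalculus.
Context {R : realType}.
Implicit Types n m : nat.

Lemma continuous_mulmx m n (A : 'M[R]_(m, n)) : continuous (mulmx A : 'cV[R]_n -> 'cV[R]_m).
Proof.
move=> x; apply/(@cvgrPdist_le _ 'cV[R]_m 'cV[R]_n (nbhs x)) => e e0; near=> y.
rewrite -mulmxBr; apply: le_trans (mulmx_norm_le _ (normr_ge0 A) (coord_le_norm A)) _.
have B0 : 0 <= n%:R * `|A| by rewrite mulr_ge0.
apply: (@le_trans _ _ ((n%:R * `|A| + 1) * `|x - y|)).
  by rewrite ler_wpM2r// lerDl.
rewrite mulrC -ler_pdivlMr ?ltr_wpDl//.
near: y; apply: cvgr_dist_le; first exact: cvg_id.
by rewrite divr_gt0 // ltr_wpDl.
Unshelve. all: by end_near. Qed.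

Lemma derive_grad n (h : 'cV[R]_n -> R) (x v : 'cV[R]_n) :
  differentiable h x -> 'D_v h x = dot (grad h x) v.
Proof.
move=> dh; rewrite deriveE// [in LHS](matrix_sum_delta v).
rewrite linear_sum; apply: eq_bigr => i _ /=.
by rewrite big_ord1 linearZ /= /grad mxE deriveE// mulrC.
Qed.

Lemma is_derive_line n (h : 'cV[R]_n -> R) (x v : 'cV[R]_n) (t : R) :
  differentiable h (x + t *: v) ->
  is_derive t 1 (fun s : R => h (x + s *: v)) (dot (grad h (x + t *: v)) v).
Proof.
move=> dh; have dv := @diff_derivable _ _ _ h _ v dh.
have e : (fun s : R => s^-1 *: ((fun s : R => h (x + s *: v)) (s *: 1 + t) - h (x + t *: v)))
    = (fun s => s^-1 *: ((h \o shift (x + t *: v)) (s *: v) - h (x + t *: v))).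
  apply/funext => s /=; do 3!congr (_ _).
  by rewrite [s *: 1]mulr1 scalerDl addrCA addrA.
split; first by rewrite /derivable e.
by rewrite -derive_grad// /derive e.
Qed.

Lemma mvt_line n (h : 'cV[R]_n -> R) (x v : 'cV[R]_n) :
  (forall y, differentiable h y) ->
  exists2 c : R, 0 <= c <= 1 & h (x + v) - h x = dot (grad h (x + c *: v)) v.
Proof.
move=> dh.
have [|c c01] := @MVT_segment R (fun s : R => h (x + s *: v))
    (fun t => dot (grad h (x + t *: v)) v) 0 1 ler01 (fun t _ => is_derive_line (dh _)).
  apply: derivable_within_continuous => t _.
  exact: @ex_derive _ _ _ _ _ _ _ (is_derive_line (dh _)).
rewrite scale1r scale0r addr0 subr0 mulr1 => e.
by exists c => //; rewrite in_itv /= in c01.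
Qed.

Lemma norm_segment_le n (x v : 'cV[R]_n) (c r : R) :
  0 <= c <= 1 -> `|x| <= r -> `|x + v| <= r -> `|x + c *: v| <= r.
Proof.
move=> /andP[c0 c1] xr xvr.
have -> : x + c *: v = (1 - c) *: x + c *: (x + v).
  by rewrite scalerBl scale1r scalerDr addrA subrK.
apply: le_trans (ler_normD _ _) _; rewrite !normrZ !ger0_norm ?subr_ge0//.
have -> : r = (1 - c) * r + c * r by ring.
by rewrite lerD// ler_wpM2l ?subr_ge0.
Qed.

Lemma differentiable_gradcoord n (h : 'cV[R]_n -> R) i x :
  differentiable (grad h) x -> differentiable (fun y => grad h y i 0 : R) x.
Proof.
move=> dg; apply: (@differentiable_comp _ _ _ _ (grad h) (fun M : 'cV[R]_n => M i 0 : R)) => //.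
exact: differentiable_coord.
Qed.

Lemma hess_bounded n (h : 'cV[R]_n -> R) (r : R) :
  twice_continuously_differentiable h ->
  exists2 B, 0 <= B & forall x i j, `|x| <= r -> `|hess h x i j| <= B.
Proof.
case=> _ _ hc; have [B B0 hB] := continuous_bounded_cball r hc.
by exists B => // x i j xr; apply: le_trans (coord_le_norm _ _ _) (hB _ xr).
Qed.

Lemma grad_lipschitz_cball n (h : 'cV[R]_n -> R) (r : R) :
  twice_continuously_differentiable h ->
  exists2 L, 0 <= L & forall x y, `|x| <= r -> `|y| <= r ->
    `|grad h y - grad h x| <= L * `|y - x|.
Proof.
move=> hC2; have [B B0 hB] := hess_bounded r hC2.
case: hC2 => _ dg _.
exists (n%:R * B); first exact: mulr_ge0.
move=> x y xr yr; apply: norm_le_coord => [|i]; first by rewrite !mulr_ge0.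
have [c c01] := @mvt_line n (fun z => grad h z i 0) x (y - x)
  (fun z => differentiable_gradcoord i (dg z)).
rewrite (subrKC x y) => e.
have -> : (grad h y - grad h x) i 0 = grad h y i 0 - grad h x i 0 by rewrite !mxE.
rewrite e; apply: le_trans (norm_dot_le _ _) _.
rewrite -mulrA ler_wpM2l// ler_wpM2r//.
apply: norm_le_coord => // j.
have := hB (x + c *: (y - x)) i j; rewrite /hess /grad !mxE; apply.
by apply: norm_segment_le => //; rewrite subrKC.
Qed.

(** The mean value theorem turns the remainder into a difference of gradients paired with y - x.
    Compared with the integral form a factor 1/2 is lost, which is harmless here. *)
Lemma grad_descent_cball n (h : 'cV[R]_n -> R) (r : R) :
  twice_continuously_differentiable h ->
  exists2 L, 0 <= L & forall x y, `|x| <= r -> `|y| <= r ->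
    `|h y - h x - dot (grad h x) (y - x)| <= L * `|y - x| ^+ 2.
Proof.
move=> hC2; have [L L0 hL] := grad_lipschitz_cball r hC2.
exists (n%:R * L); first exact: mulr_ge0.
case: hC2 => dh _ _ x y xr yr.
have [c /[dup] c01 /andP[c0 c1]] := @mvt_line n h x (y - x) dh.
rewrite (subrKC x y) => ->; rewrite -dotNl -dotDl.
apply: le_trans (norm_dot_le _ _) _.
rewrite -mulrA ler_wpM2l// expr2 mulrA ler_wpM2r//.
apply: le_trans (hL _ _ xr _) _.
  by apply: norm_segment_le => //; rewrite subrKC.
rewrite ler_wpM2l// [x + _]addrC addrK normrZ ger0_norm//.
by rewrite ler_piMl.
Qed.

End GradientCalculus.

(** * The smooth part f(Ax) *)

Section ComposedGradient.
Context {R : realType} {m n : nat}.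
Variables (f : 'cV[R]_m -> R) (A : 'M[R]_(m, n)).
Hypothesis f_C2 : twice_continuously_differentiable f.

Lemma differentiable_psi x : differentiable (psi f A) x.
Proof.
case: f_C2 => df _ _; apply: (@differentiable_comp _ _ _ _ (mulmx A) f) => //.
apply: linear_differentiable; exact: continuous_mulmx.
Qed.

Lemma derive_psi x v : 'D_v (psi f A) x = dot (grad f (A *m x)) (A *m v).
Proof.
case: f_C2 => df _ _; rewrite -derive_grad// /derive.
suff -> : (fun t : R => t^-1 *: ((psi f A \o shift x) (t *: v) - psi f A x)) =
  (fun t => t^-1 *: ((f \o shift (A *m x)) (t *: (A *m v)) - f (A *m x))) by [].
by apply/funext => t /=; rewrite /psi mulmxDr -scalemxAr.
Qed.

Lemma grad_psi x : grad (psi f A) x = A^T *m grad f (A *m x).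
Proof.
apply/colP => i; rewrite /grad mxE derive_psi -dot_trmul.
by rewrite dot_delta.
Qed.

Lemma dot_grad_psi x v : dot (grad (psi f A) x) v = dot (grad f (A *m x)) (A *m v).
Proof. by rewrite grad_psi dot_trmul. Qed.

Lemma continuous_grad_psi : continuous (grad (psi f A)).
Proof.
have -> : grad (psi f A) = (mulmx A^T) \o (grad f) \o (mulmx A).
  by apply/funext => x; rewrite grad_psi.
case: f_C2 => _ dg _ x; apply: continuous_comp; first exact: continuous_mulmx.
apply: continuous_comp; first exact: differentiable_continuous.
exact: continuous_mulmx.
Qed.

Lemma psi_descent_cball (r : R) :
  exists2 L, 0 <= L & forall x y, `|x| <= r -> `|y| <= r ->
    `|psi f A y - psi f A x - dot (grad (psi f A) x) (y - x)| <= L * `|y - x| ^+ 2.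
Proof.
set c := n%:R * `|A|; have c0 : 0 <= c by rewrite mulr_ge0.
have Ac (v : 'cV[R]_n) : `|A *m v| <= c * `|v|.
  exact: mulmx_norm_le (normr_ge0 A) (coord_le_norm A).
have [L L0 hL] := grad_descent_cball (c * r) f_C2.
exists (L * c ^+ 2); first by rewrite mulr_ge0// sqr_ge0.
move=> x y xr yr; rewrite dot_grad_psi mulmxBr.
apply: le_trans (hL _ _ _ _) _.
- by apply: le_trans (Ac _) _; rewrite ler_wpM2l.
- by apply: le_trans (Ac _) _; rewrite ler_wpM2l.
rewrite -mulrA ler_wpM2l// -exprMn -mulmxBr ler_pXn2r ?nnegrE ?mulr_ge0//.
Qed.

Lemma grad_psi_bounded (r : R) :
  exists2 B, 0 <= B & forall x, `|x| <= r -> `|grad (psi f A) x| <= B.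
Proof. exact: continuous_bounded_cball continuous_grad_psi. Qed.

End ComposedGradient.

Section AbsMin.
Context {R : realType} {n : nat}.
Implicit Types x : 'cV[R]_n.

Lemma in_supp x i : (i \in supp x) = (x i 0 != 0).
Proof. by rewrite inE. Qed.

Lemma absmin_le x i : x i 0 != 0 -> absmin x <= `|x i 0|.
Proof. by move=> xi; apply: bigmin_le_cond; rewrite in_supp. Qed.

Lemma absmin_attained x : x != 0 -> exists2 i, x i 0 != 0 & absmin x = `|x i 0|.
Proof.
move=> x0; have nx0 : `|x| != 0 by rewrite normr_eq0.
rewrite /absmin; elim/big_ind: _ => [|a b [i xi ->] [j xj ->]|i].
- have [[i j]] := mx_norm_neq0 nx0; rewrite (ord1 j) => e.
  by exists i; [rewrite -normr_eq0 -e|exact: e].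
- by rewrite /Num.min; case: ifP => _; [exists i|exists j].
- by rewrite in_supp => xi; exists i.
Qed.

Lemma absmin_gt0 x : x != 0 -> 0 < absmin x.
Proof. by case/absmin_attained => i xi ->; rewrite normr_gt0. Qed.

End AbsMin.

(** * The one-dimensional proximal problem for |t|^q *)

Section ScalarPenalty.
Context {R : realType}.
Variables (lambda q : R).
Hypotheses (lambda_gt0 : 0 < lambda) (q_gt0_lt1 : 0 < q < 1).

Let q_gt0 : 0 < q. Proof. by case/andP: q_gt0_lt1. Qed.
Let q_lt1 : q < 1. Proof. by case/andP: q_gt0_lt1. Qed.

Lemma powR_sub2 (t : R) : 0 < t -> t `^ q = t `^ (q - 2) * t ^+ 2.
Proof.
move=> t0; rewrite (powR_pred _ t0) (powR_pred (q - 1) t0) expr2 mulrA.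
by congr (_ `^ _ * _ * _); ring.
Qed.

(* Comparing z with its multiples s z, and bounding s^q by its tangent line at
   s = 1, gives the first-order condition without differentiation. *)
Lemma scalar_prox_stationary (mu z y : R) : z != 0 ->
  (forall t, mu / 2 * (z - y) ^+ 2 + lambda * `|z| `^ q
             <= mu / 2 * (t - y) ^+ 2 + lambda * `|t| `^ q) ->
  mu * (z - y) * z + lambda * q * `|z| `^ q = 0.
Proof.
move=> z0 hz; set c := _ + _.
have key (e : R) : -1 < e -> 0 <= e * c + mu / 2 * e ^+ 2 * z ^+ 2.
  move=> e1; have s0 : 0 <= 1 + e by lra.
  have := hz ((1 + e) * z).
  rewrite normrM (ger0_norm s0) (powRM _ s0 (normr_ge0 z)).
  have /(ler_wpM2r (powR_ge0 `|z| q)) := powR_le_tangent1 q_gt0_lt1 s0.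
  move=> /(ler_wpM2l (ltW lambda_gt0)) h1 h2.
  have := le_trans h2 (lerD (lexx _) h1); rewrite -subr_ge0 => h3.
  suff -> : e * c + mu / 2 * e ^+ 2 * z ^+ 2 = mu / 2 * ((1 + e) * z - y) ^+ 2 +
    lambda * ((1 + q * (1 + e - 1)) * `|z| `^ q) -
    (mu / 2 * (z - y) ^+ 2 + lambda * `|z| `^ q) by [].
  by rewrite /c; field.
set M := mu / 2 * z ^+ 2.
have key' (e : R) : -1 < e -> 0 <= e * (c + e * M).
  move=> /key; suff -> : e * (c + e * M) = e * c + mu / 2 * e ^+ 2 * z ^+ 2 by [].
  by rewrite /M; ring.
have K0 : 0 < 2 * (`|c| + `|M| + 1) by have := normr_ge0 c; have := normr_ge0 M; lra.
(* By [key'], e (c + e M) >= 0 for every e > -1. Tested at minus a small multiple of c this is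
   negative unless c = 0; the denominator ensures both |e| < 1 and dominance over M. *)
pose e := c / (2 * (`|c| + `|M| + 1)).
have eK : e * (2 * (`|c| + `|M| + 1)) = c by rewrite /e divfK// gt_eqF.
have e1 : `|e| < 1.
  rewrite /e normrM normfV (gtr0_norm K0) ltr_pdivrMr// mul1r.
  by have := normr_ge0 c; have := normr_ge0 M; lra.
have h : e * (c - e * M) <= 0.
  have -> : e * (c - e * M) = - (- e * (c + - e * M)) by ring.
  by rewrite oppr_le0; apply: key'; have := ler_norm e; lra.
have h4 : e * (c - e * M) = e ^+ 2 * (2 * (`|c| + `|M| + 1) - M).
  by rewrite -[in LHS]eK; ring.
move: h; rewrite h4 => h.
have pos : 0 < 2 * (`|c| + `|M| + 1) - M.
  by have := ler_norm M; have := normr_ge0 c; have := normr_ge0 M; lra.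
have e0 : e = 0.
  apply/eqP; rewrite -sqrf_eq0 eq_le sqr_ge0 andbT.
  by rewrite -(pmulr_lle0 _ pos).
by rewrite -eK e0 mul0r.
Qed.

(** Comparison with the competitor 0, with y eliminated by the first-order condition, gives lambda
    (1 - q) |z|^q <= mu/2 z^2; division by z^2 produces the exponent q - 2. *)
Lemma scalar_prox_bound (mu z y : R) : z != 0 ->
  (forall t, mu / 2 * (z - y) ^+ 2 + lambda * `|z| `^ q
             <= mu / 2 * (t - y) ^+ 2 + lambda * `|t| `^ q) ->
  lambda * (1 - q) * `|z| `^ (q - 2) <= mu / 2.
Proof.
move=> z0 hz; have st := scalar_prox_stationary z0 hz.
have := hz 0; rewrite normr0 powR0 ?gt_eqF// mulr0 addr0 => h.
have az : 0 < `|z| by rewrite normr_gt0.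
rewrite -(@ler_pM2r _ (`|z| ^+ 2)) ?exprn_gt0//.
rewrite -[leLHS]mulrA -(powR_sub2 az) -normrX (ger0_norm (sqr_ge0 z)).
move: h st; set P := `|z| `^ q => h st.
have : mu * z * y = mu * z ^+ 2 + lambda * q * P by rewrite -[RHS]subr0 -st; ring.
by move=> e; lra.
Qed.

(** The two sides compare increments of the derivative of the scalar model. As t^(q-1) is convex,
    its tangent at the smaller point bounds the increment from below, so the curvature there
    decides; bounds at both points keep the statement symmetric. *)
Lemma scalar_strong_monotone (mu kappa a b : R) : 0 < a -> 0 < b ->
  kappa <= mu + lambda * q * (q - 1) * a `^ (q - 2) ->
  kappa <= mu + lambda * q * (q - 1) * b `^ (q - 2) ->
  kappa * `|b - a| <= `|mu * (b - a) + lambda * q * (b `^ (q - 1) - a `^ (q - 1))|.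
Proof.
wlog ab : a b / a <= b.
  move=> H a0 b0 ka kb; have [/H|/ltW/H] := leP a b; first exact.
  rewrite distrC => /(_ b0 a0 kb ka) h; apply: le_trans h _.
  rewrite -[X in _ <= X]normrN.
  suff -> : mu * (a - b) + lambda * q * (a `^ (q - 1) - b `^ (q - 1)) =
     - (mu * (b - a) + lambda * q * (b `^ (q - 1) - a `^ (q - 1))) by [].
  by ring.
move=> a0 b0 ka _.
have := @powR_ge_tangent _ (q - 1) a b _ a0 b0.
have -> : q - 1 - 1 = q - 2 by ring.
have q1 : q - 1 <= 0 by rewrite subr_le0 ltW.
move=> /(_ q1) h; rewrite ger0_norm ?subr_ge0//.
apply: le_trans (ler_norm _).
have ba : 0 <= b - a by rewrite subr_ge0.
have h1 : lambda * q * ((q - 1) * a `^ (q - 2) * (b - a)) <=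
   lambda * q * (b `^ (q - 1) - a `^ (q - 1)).
  apply: ler_wpM2l; first by rewrite mulr_ge0// ltW.
  by rewrite lerBrDl.
have h2 := ler_wpM2r ba ka.
apply: le_trans h2 _.
have -> : (mu + lambda * q * (q - 1) * a `^ (q - 2)) * (b - a) =
  mu * (b - a) + lambda * q * ((q - 1) * a `^ (q - 2) * (b - a)) by ring.
exact: lerD.
Qed.

(** The condition |v| <= |x| keeps x + v on the closed half-line of x, where |x + v| - |x| = sg(x) v
    and concavity applies. *)
Lemma abs_powR_tangent (x v : R) : x != 0 -> `|v| <= `|x| ->
  `|x + v| `^ q <= `|x| `^ q + q * Num.sg x * `|x| `^ (q - 1) * v.
Proof.
move=> x0 vx; have ax : 0 < `|x| by rewrite normr_gt0.
apply: le_trans (powR_le_tangent q_gt0_lt1 ax (normr_ge0 _)) _.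
suff -> : `|x + v| - `|x| = Num.sg x * v by rewrite lerD2l le_eqVlt; apply/orP; left; apply/eqP; ring.
have [xpos|xneg|/eqP] := ltrgt0P x; last by rewrite (negPf x0).
- move: vx; rewrite (gtr0_norm xpos) ler_norml => /andP[v1 v2].
  by rewrite gtr0_sg// ger0_norm; [ring|lra].
- move: vx; rewrite (ltr0_norm xneg) ler_norml => /andP[v1 v2].
  by rewrite ltr0_sg// ler0_norm; [ring|lra].
Qed.

Lemma continuous_abs_powR : continuous (fun t : R => `|t| `^ q).
Proof.
move=> t; have [->|t0] := eqVneq t 0.
  rewrite /continuous_at normr0 powR0 ?gt_eqF//.
  apply/cvgrPdist_le => e e0; near=> s.
  rewrite sub0r normrN ger0_norm ?powR_ge0//.
  have eE : e = (e `^ q^-1) `^ q by rewrite -powRrM mulVf ?gt_eqF// powRr1// ltW.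
  rewrite eE; apply: ge0_ler_powR; rewrite ?nnegrE ?powR_ge0 ?(ltW q_gt0)//.
  apply/ltW.
  near: s; apply/nbhs_ballP; exists (e `^ q^-1) => /=; first exact: powR_gt0.
  by move=> s; rewrite /ball /= sub0r normrN.
have at0 : 0 < `|t| by rewrite normr_gt0.
have dp := is_derive1_powR q at0.
have cp : continuous_at (`|t| : R) (fun s : R => s `^ q).
  by apply: differentiable_continuous; apply/derivable1_diffP; exact: ex_derive.
exact: (@continuous_comp R R R (fun s => `|s|) (fun s => s `^ q) t (@norm_continuous _ _ t) cp).
Unshelve. all: by end_near. Qed.

End ScalarPenalty.

(** * The separable penalty and the coordinatewise prox *)

Section Penalty.
Context {R : realType} {n : nat}.
Variables (lambda q : R).
Hypotheses (lambda_gt0 : 0 < lambda) (q_gt0_lt1 : 0 < q < 1).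
Implicit Types (mu : R) (x z w : 'cV[R]_n).

Let q_gt0 : 0 < q. Proof. by case/andP: q_gt0_lt1. Qed.
Let q_lt1 : q < 1. Proof. by case/andP: q_gt0_lt1. Qed.

Lemma lq_ge0 x : 0 <= lq q x.
Proof. by apply: sumr_ge0 => i _; exact: powR_ge0. Qed.

Lemma lq_coord_le x i : `|x i 0| `^ q <= lq q x.
Proof.
by rewrite /lq (bigD1 i)//= lerDl; apply: sumr_ge0 => j _; exact: powR_ge0.
Qed.

Lemma lq_le_norm x r : `|x| <= r -> lq q x <= n%:R * r `^ q.
Proof.
move=> xr; have r0 := le_trans (normr_ge0 x) xr.
rewrite /lq; apply: (@le_trans _ _ (\sum_(i < n) r `^ q)); last first.
  by rewrite sumr_const card_ord mulr_natl.
apply: ler_sum => i _; apply: ge0_ler_powR; rewrite ?nnegrE//; first exact: ltW.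
exact: le_trans (coord_le_norm _ _ _) xr.
Qed.

Lemma continuous_lq : continuous (@lq R q n).
Proof.
move=> x; rewrite /continuous_at /lq.
have addc : continuous (fun y : R * R => y.1 + y.2) by move=> y; exact: add_continuous.
apply: (@cvg_big R _ _ _ _ addc _ (nbhs x)) => i _.
exact: (cvg_comp (fun y : 'cV[R]_n => y i 0) (fun t : R => `|t| `^ q)
  (@coord_continuous R n 1 i 0 x) (@continuous_abs_powR _ _ q_gt0_lt1 _)).
Qed.

Lemma prox_coord (mu : R) (y z : 'cV[R]_n) i : prox lambda q mu y z ->
  forall t, mu / 2 * (z i 0 - y i 0) ^+ 2 + lambda * `|z i 0| `^ q
            <= mu / 2 * (t - y i 0) ^+ 2 + lambda * `|t| `^ q.
Proof.
move=> zP t; pose w : 'cV[R]_n := \col_j if j == i then t else z j 0.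
have := zP w; rewrite !enorm_sqr /dot /lq.
rewrite (bigD1 i)//= [in X in _ + X <= _](bigD1 i)//=.
rewrite [in X in _ <= X](bigD1 i)//= [in X in _ <= _ + X](bigD1 i)//=.
have -> : \sum_(j < n | j != i) (w - y) j 0 * (w - y) j 0 =
          \sum_(j < n | j != i) (z - y) j 0 * (z - y) j 0.
  by apply: eq_bigr => j /negPf ji; rewrite !mxE ji.
have -> : \sum_(j < n | j != i) `|w j 0| `^ q = \sum_(j < n | j != i) `|z j 0| `^ q.
  by apply: eq_bigr => j /negPf ji; rewrite !mxE ji.
rewrite !mxE eqxx -!expr2 !mulrDr.
set S1 := mu / 2 * _; set S2 := lambda * _; set S3 := mu / 2 * _.
by set S4 := lambda * _; set S5 := mu / 2 * _; set S6 := lambda * _; lra.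
Qed.

End Penalty.

(** * Optimality of proximal gradient points *)

Section ProximalGradient.
Context {R : realType} {m n : nat}.
Variables (f : 'cV[R]_m -> R) (A : 'M[R]_(m, n)) (lambda q : R).
Hypotheses (lambda_gt0 : 0 < lambda) (q_gt0_lt1 : 0 < q < 1).
Implicit Types (mu : R) (x z w : 'cV[R]_n).

Let q_gt0 : 0 < q. Proof. by case/andP: q_gt0_lt1. Qed.
Let q_lt1 : q < 1. Proof. by case/andP: q_gt0_lt1. Qed.

(** Completing the square: the two objectives differ by a constant independent of w. This form is
    free of the inverse of mu, which suits comparisons between different parameters and passages to
    the limit. *)
Lemma prox_gradP mu x z : 0 < mu ->
  prox_grad f lambda q A mu x z <->
  forall w, mu / 2 * enorm (z - x) ^+ 2 + dot (grad (psi f A) x) (z - x) + lambda * lq q z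
         <= mu / 2 * enorm (w - x) ^+ 2 + dot (grad (psi f A) x) (w - x) + lambda * lq q w.
Proof.
move=> mu0; rewrite /prox_grad /prox /=; set g := grad _ x.
have E w : mu / 2 * enorm (w - (x - mu^-1 *: g)) ^+ 2 =
   mu / 2 * enorm (w - x) ^+ 2 + dot g (w - x) + mu^-1 / 2 * dot g g.
  have -> : w - (x - mu^-1 *: g) = (w - x) + mu^-1 *: g by rewrite opprB addrA addrAC.
  move: (w - x) => d; rewrite !enorm_sqr dotDl !dotDr !dotZl !dotZr (dotC d g).
  by field; rewrite gt_eqF.
by split=> h w; have := h w; rewrite !E; lra.
Qed.

Lemma prox_grad_stationary mu x z i : 0 < mu ->
  prox_grad f lambda q A mu x z -> z i 0 != 0 ->
  mu * (z i 0 - x i 0) + grad (psi f A) x i 0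
    + lambda * q * Num.sg (z i 0) * `|z i 0| `^ (q - 1) = 0.
Proof.
move=> mu0 zP zi; apply: (mulIf zi); rewrite mul0r.
rewrite -(scalar_prox_stationary lambda_gt0 q_gt0_lt1 zi (prox_coord i zP)).
have az : 0 < `|z i 0| by rewrite normr_gt0.
rewrite (powR_pred q az) !mxE.
have e : `|z i 0| = Num.sg (z i 0) * z i 0 by rewrite normrEsg.
rewrite [X in _ = _ + _ * (_ * X)]e.
have := gt_eqF mu0; move: (`|z i 0| `^ (q - 1)) (Num.sg _) => P s mun0.
by field; rewrite mun0.
Qed.

End ProximalGradient.

(** * The reduced gradient, and what the Newton test implies *)

Section FreeGradient.
Context {R : realType} {m n : nat}.
Variables (f : 'cV[R]_m -> R) (A : 'M[R]_(m, n)) (lambda q : R).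
Hypotheses (lambda_gt0 : 0 < lambda) (q_gt0_lt1 : 0 < q < 1).
Implicit Types (mu : R) (x z v w : 'cV[R]_n).

Let q_gt0 : 0 < q. Proof. by case/andP: q_gt0_lt1. Qed.
Let q_lt1 : q < 1. Proof. by case/andP: q_gt0_lt1. Qed.

(** This is [rvec] extended by zero off the support. Living in R^n, it can be compared across
    iterates with different supports. *)
Definition free_grad x : 'cV[R]_n :=
  \col_i if x i 0 == 0 then 0
         else grad (psi f A) x i 0 + lambda * q * Num.sg (x i 0) * `|x i 0| `^ (q - 1).

Lemma prox_grad_curvature_coord mu x z i : 0 < mu ->
  prox_grad f lambda q A mu x z -> z i 0 != 0 ->
  lambda * (1 - q) * `|z i 0| `^ (q - 2) <= mu / 2.
Proof.
move=> mu0 zP zi.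
exact: (scalar_prox_bound lambda_gt0 q_gt0_lt1 zi (prox_coord i zP)).
Qed.

(** Default values: [absmin] of the zero vector is 0, and [powR] sends 0 to 0 for a nonzero
    exponent, so the penalty term vanishes. *)
Lemma curvature0 mu : curvature lambda q mu (0 : 'cV[R]_n) = mu.
Proof.
rewrite /curvature /absmin big_pred0 => [|i]; last by rewrite in_supp mxE eqxx.
by rewrite normr0 powR0 ?mulr0 ?addr0// subr_eq0; apply/eqP => q2; have := q_lt1; lra.
Qed.

(** The scalar bound multiplied by q, at the smallest nonzero entry. The positive margin 1 - q/2
    comes from global optimality; the second-order condition alone would only give nonnegative
    curvature. *)
Lemma prox_grad_curvature mu x z : 0 < mu ->
  prox_grad f lambda q A mu x z -> mu * (1 - q / 2) <= curvature lambda q mu z.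
Proof.
move=> mu0 zP; have [->|/absmin_attained[i zi e]] := eqVneq z 0.
  by rewrite curvature0 ler_piMr ?(ltW mu0)//; have := q_gt0; lra.
have := prox_grad_curvature_coord mu0 zP zi.
rewrite /curvature e => /(ler_wpM2l (ltW q_gt0)); set P := _ `^ _; lra.
Qed.

Lemma curvature_coord mu x i : x i 0 != 0 ->
  curvature lambda q mu x <= mu + lambda * q * (q - 1) * `|x i 0| `^ (q - 2).
Proof.
move=> xi; have x0 : x != 0 by apply: contraNneq xi => ->; rewrite mxE.
have q2 : q - 2 <= 0 by have := q_lt1; lra.
have := ler_npowR q2 (absmin_gt0 x0) (absmin_le xi).
have lq0 : 0 <= lambda * q * (1 - q).
  by rewrite !mulr_ge0 ?subr_ge0 ?(ltW lambda_gt0) ?(ltW q_gt0) ?(ltW q_lt1).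
move=> /(ler_wpM2l lq0); rewrite /curvature; lra.
Qed.

(** The test passes half of the curvature at z on to x; nonnegativity of that curvature already
    keeps the entries of x away from 0. *)
Lemma newton_test_lower mu x z i : 0 < mu ->
  prox_grad f lambda q A mu x z -> newton_test lambda q x z mu -> x i 0 != 0 ->
  lambda * q * (1 - q) * `|x i 0| `^ (q - 2) <= mu.
Proof.
move=> mu0 zP /andP[_ tst] xi.
have h1 := prox_grad_curvature mu0 zP; have h2 := curvature_coord mu xi.
have : 0 <= mu * (1 - q / 2) by rewrite mulr_ge0 ?(ltW mu0)//; have := q_lt1; lra.
lra.
Qed.

Lemma sign_eq_neq0 x z i : sign x = sign z -> (x i 0 != 0) = (z i 0 != 0).
Proof.
move=> /matrixP/(_ i 0); rewrite !mxE => e.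
by rewrite -sgr_eq0 e sgr_eq0.
Qed.

(* On K2 the proximal subproblem is strongly convex between x_i and z_i, so the
   residual controls the proximal step. *)
Lemma newton_test_step_le mu x z i : 0 < mu ->
  prox_grad f lambda q A mu x z -> newton_test lambda q x z mu ->
  mu * (1 - q / 2) / 2 * `|x i 0 - z i 0| <= `|free_grad x i 0|.
Proof.
move=> mu0 zP /[dup] tst /andP[/eqP sgn ct].
have c0 : 0 <= mu * (1 - q / 2) by rewrite mulr_ge0 ?(ltW mu0)//; have := q_lt1; lra.
have [x0|xi] := eqVneq (x i 0) 0.
  have : ~~ (z i 0 != 0) by rewrite -(sign_eq_neq0 i sgn) x0 eqxx.
  by rewrite negbK => /eqP ->; rewrite x0 subrr normr0 mulr0.
have zi : z i 0 != 0 by rewrite -(sign_eq_neq0 i sgn).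
have st := prox_grad_stationary lambda_gt0 q_gt0_lt1 mu0 zP zi.
have sge : Num.sg (z i 0) = Num.sg (x i 0).
  by move: sgn => /matrixP/(_ i 0); rewrite !mxE.
have h1 := prox_grad_curvature mu0 zP.
have ax : 0 < `|x i 0| by rewrite normr_gt0.
have az : 0 < `|z i 0| by rewrite normr_gt0.
have kz : mu * (1 - q / 2) / 2 <= mu + lambda * q * (q - 1) * `|z i 0| `^ (q - 2).
  by apply: le_trans (curvature_coord mu zi); lra.
have kx : mu * (1 - q / 2) / 2 <= mu + lambda * q * (q - 1) * `|x i 0| `^ (q - 2).
  by apply: le_trans (curvature_coord mu xi); lra.
have h := scalar_strong_monotone lambda_gt0 q_gt0_lt1 az ax kz kx.
have ex : x i 0 = Num.sg (x i 0) * `|x i 0| by rewrite -numEsg.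
have ez : z i 0 = Num.sg (x i 0) * `|z i 0| by rewrite -sge -numEsg.
have e1 : x i 0 - z i 0 = Num.sg (x i 0) * (`|x i 0| - `|z i 0|).
  by rewrite mulrBr -ex -ez.
have sg1 : `|Num.sg (x i 0)| = 1 by rewrite normr_sg xi.
have -> : `|x i 0 - z i 0| = `| `|x i 0| - `|z i 0| |.
  by rewrite e1 normrM sg1 mul1r.
apply: le_trans h _; rewrite mxE (negPf xi).
(* Stationarity of z involves the gradient of [psi f A] at x, so subtracting it leaves only the
   difference of scalar model derivatives. *)
have -> : grad (psi f A) x i 0 + lambda * q * Num.sg (x i 0) * `|x i 0| `^ (q - 1)
  = Num.sg (x i 0) * (mu * (`|x i 0| - `|z i 0|) +
     lambda * q * (`|x i 0| `^ (q - 1) - `|z i 0| `^ (q - 1))); last first.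
  by rewrite normrM sg1 mul1r.
rewrite mulrDr mulrCA -e1 -[LHS]subr0 -st sge; ring.
Qed.

(** Let Z be the penalty curvature lambda q (1 - q) |z_j|^(q-2) at the smallest nonzero entry of z.
    The tolerance 1/10 gives (9/10)^(q-2) <= (9/10)^(-2) <= 3/2, so at x the curvature is at least
    mu - 3/2 Z. This is at least (mu - Z)/2 exactly when Z <= mu/2, which the scalar prox bound
    provides. *)
Lemma newton_test_close mu x z : 0 < mu ->
  prox_grad f lambda q A mu x z -> sign x = sign z ->
  (forall i, `|x i 0 - z i 0| <= `|z i 0| / 10) -> newton_test lambda q x z mu.
Proof.
move=> mu0 zP sgn cl; apply/andP; split; first exact/eqP.
have cz := prox_grad_curvature mu0 zP.
have c0 : 0 <= mu * (1 - q / 2) by rewrite mulr_ge0 ?(ltW mu0)//; have := q_lt1; lra.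
have [x0|/absmin_attained[i xi e]] := eqVneq x 0.
  have -> : z = x by apply/colP => i; apply/eqP; rewrite x0 mxE -[_ == _]negbK -(sign_eq_neq0 i sgn) x0 mxE eqxx.
  rewrite x0 curvature0; lra.
have zi : z i 0 != 0 by rewrite -(sign_eq_neq0 i sgn).
have [j zj ez] : exists2 j, z j 0 != 0 & absmin z = `|z j 0|.
  by apply: absmin_attained; apply: contraNneq zi => ->; rewrite mxE.
have aj : 0 < `|z j 0| by rewrite normr_gt0.
have xz : 9 / 10 * `|z j 0| <= `|x i 0|.
  have := absmin_le zi; rewrite ez; have := cl i; rewrite distrC.
  by have := lerB_normD (z i 0) (x i 0 - z i 0); rewrite subrKC; have := cl i; lra.
have q2 : q - 2 <= 0 by have := q_lt1; lra.
have P1 : `|x i 0| `^ (q - 2) <= (9 / 10) `^ (q - 2) * `|z j 0| `^ (q - 2).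
  rewrite -powRM//; apply: ler_npowR => //; lra.
have P2 : (9 / 10 : R) `^ (q - 2) <= 3 / 2.
  apply: (@le_trans _ _ ((9 / 10) `^ (- 2%:R))).
    by apply: ger_powR; [apply/andP; split; lra|have := q_gt0; lra].
  by rewrite powR_invn//; lra.
have P3 := prox_grad_curvature_coord mu0 zP zj.
have lq0 : 0 <= lambda * q * (1 - q).
  by rewrite !mulr_ge0 ?subr_ge0 ?(ltW lambda_gt0) ?(ltW q_gt0) ?(ltW q_lt1).
have P4 : lambda * q * (1 - q) * `|x i 0| `^ (q - 2) <=
    3 / 2 * (lambda * q * (1 - q) * `|z j 0| `^ (q - 2)).
  apply: le_trans (ler_wpM2l lq0 P1) _.
  rewrite mulrCA; apply: ler_wpM2r P2; rewrite mulr_ge0// powR_ge0.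
have P5 := ler_wpM2l (ltW q_gt0) P3.
have P6 : q * (mu / 2) <= mu / 2 by rewrite ler_piMl// ?divr_ge0// ltW.
rewrite /curvature e ez.
move: P4 P5 P6; set Z := `|z j 0| `^ _; set X := `|x i 0| `^ _; lra.
Qed.

(** Comparing z with x bounds a quadratic in |z - x| by an affine function, uniformly in mu >=
    mu_min. This confines all trial points to one ball, where a descent constant is available. *)
Lemma prox_grad_step_bound (mu_min r B : R) : 0 < mu_min -> 0 <= B ->
  exists s, forall mu x z, mu_min <= mu -> `|x| <= r -> `|grad (psi f A) x| <= B ->
    prox_grad f lambda q A mu x z -> `|z - x| <= s.
Proof.
move=> mm0 B0.
pose K := n%:R * B + lambda * (n%:R * r `^ q).
have K0 : 0 <= K.
  by rewrite /K addr_ge0// mulr_ge0// ?(ltW lambda_gt0)// mulr_ge0// powR_ge0.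
exists (1 + 2 / mu_min * K) => mu x z mmu xr gB.
have mu0 : 0 < mu by apply: lt_le_trans mmu.
move=> /(prox_gradP _ _ _ _ _ _ mu0)/(_ x).
have -> : enorm (x - x) ^+ 2 = 0 by rewrite subrr enorm0 expr0n.
have -> : dot (grad (psi f A) x) (x - x) = 0.
  by rewrite subrr /dot big1// => i _; rewrite [X in _ * X]mxE mulr0.
set s := `|z - x|; set G := grad _ _ => h.
have s0 : 0 <= s by exact: normr_ge0.
have h1 : `|dot G (z - x)| <= n%:R * B * s.
  apply: le_trans (norm_dot_le _ _) _.
  by rewrite -mulrA ler_wpM2l// ler_wpM2r.
have h2 : lambda * lq q x <= lambda * (n%:R * r `^ q).
  by rewrite ler_wpM2l ?(ltW lambda_gt0)// lq_le_norm.
have h3 : 0 <= lambda * lq q z by rewrite mulr_ge0 ?lq_ge0 ?(ltW lambda_gt0).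
have h4 : mu_min / 2 * s ^+ 2 <= mu / 2 * enorm (z - x) ^+ 2.
  apply: ler_pM; rewrite ?sqr_ge0 ?divr_ge0 ?(ltW mm0)//; first lra.
  by rewrite ler_pXn2r ?nnegrE ?enorm_ge0// norm_le_enorm.
have h5 : mu_min / 2 * s ^+ 2 <= n%:R * B * s + lambda * (n%:R * r `^ q).
  by move: h1; rewrite ler_norml => /andP[h1 _]; lra.
have [s1|s1] := leP s 1.
  apply: le_trans s1 _; rewrite lerDl mulr_ge0// divr_ge0// ltW//.
have h6 : mu_min / 2 * s ^+ 2 <= K * s.
  apply: le_trans h5 _; rewrite /K mulrDl lerD2l ler_peMr ?(ltW s1)//.
  by rewrite mulr_ge0 ?(ltW lambda_gt0)// mulr_ge0// powR_ge0.
have {}h6 : mu_min / 2 * s <= K.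
  by rewrite -(ler_pM2r (lt_trans ltr01 s1)); move: h6; rewrite expr2 mulrA.
have -> : 2 / mu_min * K = K / (mu_min / 2) by field; rewrite gt_eqF.
apply: (@le_trans _ _ (K / (mu_min / 2))); last by rewrite lerDr.
by rewrite ler_pdivlMr ?divr_gt0// mulrC.
Qed.

End FreeGradient.

(** * Derivatives of powers of absolute values *)

Section Derivatives.
Context {R : realType}.

Lemma near_neq0_sg (x : R) : x != 0 ->
  \forall t \near x, t != 0 /\ Num.sg t = Num.sg x.
Proof.
move=> x0; near=> t.
have tx : `|x - t| < `|x|.
  near: t; apply/nbhs_ballP; exists `|x| => //=; first by rewrite normr_gt0.
have := tx; rewrite ltr_norml.
have [xp|xn|/eqP] := ltrgt0P x; last by rewrite (negPf x0).
  move=> /andP[t1 t2]; have tp : 0 < t by lra.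
  by split; [rewrite gt_eqF|rewrite !gtr0_sg].
move=> /andP[t1 t2]; have tn : t < 0 by lra.
by split; [rewrite lt_eqF|rewrite !ltr0_sg].
Unshelve. all: by end_near. Qed.

Lemma is_derive_abs_powR (p x : R) : x != 0 ->
  is_derive x 1 (fun t : R => `|t| `^ p) (p * Num.sg x * `|x| `^ (p - 1)).
Proof.
move=> x0; have ax : 0 < Num.sg x * x by rewrite -normrEsg normr_gt0.
apply: (@near_eq_is_derive _ _ _ (fun t : R => (Num.sg x * t) `^ p)).
  near=> t; congr (_ `^ _); rewrite normrEsg.
  suff [_ ->] : t != 0 /\ Num.sg t = Num.sg x by [].
  by near: t; exact: near_neq0_sg.
have d1 : is_derive x (1 : R) (fun t : R => Num.sg x * t) (Num.sg x).
  have := @is_deriveZ R R R id (Num.sg x) x 1 1 (is_derive_id x 1).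
  by rewrite [_ *: 1]mulr1.
have d2 := is_derive1_powR p ax.
have -> : p * Num.sg x * `|x| `^ (p - 1) = p * (Num.sg x * x) `^ (p - 1) * Num.sg x.
  by rewrite -normrEsg; ring.
exact: (@is_derive1_comp _ (fun s : R => s `^ p) (fun t : R => Num.sg x * t) x _ _ d2 d1).
Unshelve. all: by end_near. Qed.

(** The premise is guarded by i = j because p may fail to be differentiable at the other entries,
    which are allowed to vanish; along direction i those terms are constant. *)
Lemma is_derive_coord n (p : R -> R) (u : 'cV[R]_n) (d : R) i j :
  (i = j -> is_derive (u j 0) 1 p d) ->
  is_derive u (delta_mx i 0) (fun y : 'cV[R]_n => p (y j 0)) (d *+ (i == j)).
Proof.
have [<- /(_ erefl) [dp <-]|ij _] := eqVneq i j.
  have e : (fun s : R => s^-1 *: (((fun y : 'cV[R]_n => p (y i 0)) \o shift u) (s *: delta_mx i 0) - p (u i 0)))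
    = (fun s : R => s^-1 *: ((p \o shift (u i 0)) (s *: 1) - p (u i 0))).
    by apply/funext => s /=; rewrite !mxE !eqxx.
  by split; rewrite /derivable /derive /= e.
have e : (fun s : R => s^-1 *: (((fun y : 'cV[R]_n => p (y j 0)) \o shift u) (s *: delta_mx i 0) - p (u j 0)))
    = cst 0.
  apply/funext => s /=.
  by rewrite !mxE eq_sym (negPf ij) /= mulr0 add0r subrr scaler0.
split; rewrite /derivable /derive /= e; first exact: is_cvg_cst.
by rewrite mulr0n; apply: cvg_lim => //; exact: cvg_cst.
Qed.

End Derivatives.

(** * Gradient and Hessian of the objective at nonzero entries *)

Section ObjectiveDerivatives.
Context {R : realType} {m : nat}.
Variables (f : 'cV[R]_m -> R) (lambda q : R).
Hypotheses (f_C2 : twice_continuously_differentiable f).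
Hypotheses (lambda_gt0 : 0 < lambda) (q_gt0_lt1 : 0 < q < 1).

Lemma grad_F n (A : 'M[R]_(m, n)) (u : 'cV[R]_n) i : u i 0 != 0 ->
  grad (F f lambda q A) u i 0 = free_grad f A lambda q u i 0.
Proof.
move=> ui; rewrite /free_grad [RHS]mxE (negPf ui) /grad !mxE.
pose d j : R := (q * Num.sg (u j 0) * `|u j 0| `^ (q - 1)) *+ (i == j).
have dlq : is_derive u (delta_mx i 0) (@lq R q n) (\sum_(j < n) d j).
  have -> : @lq R q n = \sum_(j < n) (fun y : 'cV[R]_n => `|y j 0| `^ q).
    by apply/funext => y; rewrite /lq fct_sumE.
  apply: is_derive_sum => j.
  apply: (@is_derive_coord _ _ (fun t => `|t| `^ q)) => ij.
  by apply: is_derive_abs_powR; rewrite -ij.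
have sd : \sum_(j < n) d j = q * Num.sg (u i 0) * `|u i 0| `^ (q - 1).
  rewrite (bigD1 i)//= big1 ?addr0 ?/d ?eqxx// => j.
  by rewrite eq_sym => /negPf ->; rewrite mulr0n.
rewrite sd in dlq.
have dpsi : is_derive u (delta_mx i 0) (psi f A) ('D_(delta_mx i 0) (psi f A) u).
  by apply: derivableP; apply: diff_derivable; exact: differentiable_psi.
have -> : @F R m f lambda q n A = psi f A + lambda \*: (@lq R q n) by [].
by rewrite (@derive_val _ _ _ _ _ _ _ (is_deriveD dpsi (is_deriveZ lambda dlq))) /GRing.scale /= !mulrA.
Qed.

Lemma derive_comp_mulmx n (A : 'M[R]_(m, n)) (h : 'cV[R]_m -> R) (x v : 'cV[R]_n) :
  'D_v (fun y => h (A *m y)) x = 'D_(A *m v) h (A *m x).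
Proof.
suff e : (fun t : R => t^-1 *: (((fun y => h (A *m y)) \o shift x) (t *: v) - h (A *m x))) =
  (fun t => t^-1 *: ((h \o shift (A *m x)) (t *: (A *m v)) - h (A *m x))).
  by rewrite /derive /= e.
by apply/funext => t /=; rewrite mulmxDr -scalemxAr.
Qed.

Lemma differentiable_dot_grad (w z : 'cV[R]_m) :
  differentiable (fun y => dot (grad f y) w) z.
Proof.
have -> : (fun y => dot (grad f y) w) = \sum_(k < m) (w k 0 *: (fun y => grad f y k 0 : R)).
  apply/funext => y; rewrite fct_sumE; apply: eq_bigr => k _.
  by rewrite mulrC.
apply: differentiable_sum => k; apply: differentiableZ.
by apply: differentiable_gradcoord; case: f_C2.
Qed.

Lemma derive_dot_grad (w z v : 'cV[R]_m) :
  'D_v (fun y => dot (grad f y) w) z =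
  \sum_(k < m) w k 0 * \sum_(l < m) hess f z k l * v l 0.
Proof.
have -> : (fun y => dot (grad f y) w) = \sum_(k < m) (w k 0 *: (fun y => grad f y k 0 : R)).
  by apply/funext => y; rewrite fct_sumE; apply: eq_bigr => k _; rewrite mulrC.
have dg k : differentiable (fun y => grad f y k 0 : R) z.
  by apply: differentiable_gradcoord; case: f_C2.
rewrite derive_sum => [|k]; last first.
  by apply: derivableZ; exact: diff_derivable.
apply: eq_bigr => k _; rewrite deriveZ; last exact: diff_derivable.
rewrite derive_grad//; congr (_ * _); apply: eq_bigr => l _.
by congr (_ * _); rewrite /hess /grad !mxE.
Qed.

Lemma norm_derive_dot_grad_le (w z v : 'cV[R]_m) (B : R) :
  0 <= B -> (forall k l, `|hess f z k l| <= B) ->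
  `|'D_v (fun y => dot (grad f y) w) z| <= m%:R * (`|w| * (m%:R * (B * `|v|))).
Proof.
move=> B0 hB; rewrite derive_dot_grad; apply: le_trans (ler_norm_sum _ _ _) _.
rewrite [leRHS]mulr_natl -[m in _ *+ m]card_ord -sumr_const; apply: ler_sum => k _.
rewrite normrM ler_pM ?coord_le_norm//; apply: le_trans (ler_norm_sum _ _ _) _.
rewrite [leRHS]mulr_natl -[m in _ *+ m]card_ord -sumr_const; apply: ler_sum => l _.
by rewrite normrM ler_pM ?coord_le_norm.
Qed.

Lemma hess_F n (A : 'M[R]_(m, n)) (u : 'cV[R]_n) i j : u i 0 != 0 ->
  hess (F f lambda q A) u i j =
  'D_(A *m delta_mx j 0) (fun z => dot (grad f z) (A *m delta_mx i 0)) (A *m u)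
  + (lambda * q * (q - 1) * `|u i 0| `^ (q - 2)) *+ (j == i).
Proof.
move=> ui; rewrite [LHS]mxE.
pose g (y : 'cV[R]_n) := dot (grad f (A *m y)) (A *m delta_mx i 0).
pose p (t : R) := `|t| `^ (q - 1).
pose c := lambda * q * Num.sg (u i 0).
(* The explicit gradient formula holds only while coordinate i is nonzero, hence the replacement
   near u, where the sign of that coordinate is also constant. *)
have -> : 'D_(delta_mx j 0) (fun y => grad (F f lambda q A) y i 0) u =
    'D_(delta_mx j 0) (g + c \*: (fun y => p (y i 0))) u.
  apply: near_eq_derive; near=> y.
  have [yi sg] : y i 0 != 0 /\ Num.sg (y i 0) = Num.sg (u i 0).
    by near: y; exact: (@coord_continuous R n 1 i 0 u _ (near_neq0_sg ui)).
  rewrite grad_F// /free_grad mxE (negPf yi) sg.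
  by rewrite -[grad _ y i 0]dot_delta dot_grad_psi.
have dg : is_derive u (delta_mx j 0) g ('D_(delta_mx j 0) g u).
  apply: derivableP; apply: diff_derivable.
  apply: (@differentiable_comp _ _ _ _ (mulmx A) (fun z => dot (grad f z) (A *m delta_mx i 0))).
    apply: linear_differentiable; exact: continuous_mulmx.
  exact: differentiable_dot_grad.
have dp := @is_derive_coord _ _ p u _ j i (fun _ => is_derive_abs_powR (q - 1) ui).
rewrite (@derive_val _ _ _ _ _ _ _ (is_deriveD dg (is_deriveZ c dp))).
rewrite (derive_comp_mulmx A (fun z => dot (grad f z) (A *m delta_mx i 0)) u (delta_mx j 0)).
set D := 'D_ _ _ _; clearbody D; rewrite /GRing.scale /= /c; apply: (congr1 (+%R D)).
have -> : q - 1 - 1 = q - 2 by ring.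
case: (j == i); rewrite ?mulr0n ?mulr0// !mulr1n.
have s2 : Num.sg (u i 0) * Num.sg (u i 0) = 1 by rewrite -expr2 sqr_sg ui.
rewrite -[RHS]mulr1 -s2; move: (Num.sg _) (`|_| `^ _) => sg P; ring.
Unshelve. all: by end_near. Qed.

(** Uniformity in the dimension and the matrix lets one constant serve all restrictions to supports
    at once. *)
Lemma hess_F_bounded (n0 : nat) (a r nu : R) : 0 <= a -> 0 <= r -> 0 < nu ->
  exists2 C, 0 <= C & forall n (A : 'M[R]_(m, n)) (u : 'cV[R]_n), (n <= n0)%N ->
    (forall i j, `|A i j| <= a) -> `|u| <= r -> (forall i, nu <= `|u i 0|) ->
    forall i j, `|hess (F f lambda q A) u i j| <= C.
Proof.
move=> a0 r0 nu0; have /andP[q0 q1] := q_gt0_lt1.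
have [B B0 hB] := hess_bounded (n0%:R * a * r) f_C2.
have l0 : 0 <= lambda * q * (1 - q).
  by rewrite !mulr_ge0 ?subr_ge0 ?(ltW lambda_gt0) ?(ltW q0) ?(ltW q1).
exists (m%:R * (a * (m%:R * (B * a))) + lambda * q * (1 - q) * nu `^ (q - 2)).
  by rewrite addr_ge0 ?mulr_ge0 ?powR_ge0 ?subr_ge0 ?(ltW lambda_gt0) ?(ltW q0) ?(ltW q1).
move=> n A u nn0 Aa ur unu i j.
have ui : u i 0 != 0 by rewrite -normr_gt0; apply: lt_le_trans (unu i).
have Ae k : `|A *m (delta_mx k 0 : 'cV[R]_n)| <= a.
  by apply: norm_le_coord => // l; rewrite -colE mxE.
rewrite hess_F//; apply: le_trans (ler_normD _ _) _; apply: lerD.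
  apply: (le_trans (@norm_derive_dot_grad_le _ _ _ B _ _)) => //.
    move=> k l; apply: hB; apply: le_trans (mulmx_norm_le _ a0 Aa) _.
    by rewrite ler_pM ?mulr_ge0// ler_wpM2r// ler_nat.
  by rewrite ler_wpM2l// ler_pM ?mulr_ge0// ler_wpM2l// ler_wpM2l.
have q2 : q - 2 <= 0 by lra.
have := ler_npowR q2 nu0 (unu i).
move=> /(ler_wpM2l l0); set X := `|u i 0| `^ _ => h.
have X0 : 0 <= lambda * q * (1 - q) * X by rewrite mulr_ge0// powR_ge0.
apply: le_trans h; case: (j == i); last by rewrite mulr0n normr0.
rewrite mulr1n -normrN ger0_norm; last by lra.
lra.
Qed.

End ObjectiveDerivatives.

(** * Descent lemma, subgradients, level sets and backtracking *)

Section Subgradients.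
Context {R : realType} {m n : nat}.
Variables (f : 'cV[R]_m -> R) (A : 'M[R]_(m, n)) (lambda q : R).
Hypotheses (f_C2 : twice_continuously_differentiable f).
Hypotheses (lambda_gt0 : 0 < lambda) (q_gt0_lt1 : 0 < q < 1).
Implicit Types (mu : R) (x z v w : 'cV[R]_n).

Let q_gt0 : 0 < q. Proof. by case/andP: q_gt0_lt1. Qed.
Let q_lt1 : q < 1. Proof. by case/andP: q_gt0_lt1. Qed.

(* Concavity of t |-> t^q on each half-line makes the penalty harmless in the
   descent lemma as long as no entry of x changes sign. *)
Lemma F_free_descent (r : R) :
  exists2 L, 0 <= L & forall x v, `|x| <= r -> `|x + v| <= r ->
    (forall i, `|v i 0| <= `|x i 0|) ->
    F f lambda q A (x + v) <=
      F f lambda q A x + dot (free_grad f A lambda q x) v + L * `|v| ^+ 2.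
Proof.
have [L L0 hL] := psi_descent_cball A f_C2 r.
exists L => // x v xr xvr vx.
have := hL x (x + v) xr xvr; rewrite (addrC x v) addrK ler_norml => /andP[_].
rewrite (addrC v x) => h1.
have h2 : lq q (x + v) <= lq q x +
   \sum_i (if x i 0 == 0 then 0 else q * Num.sg (x i 0) * `|x i 0| `^ (q - 1) * v i 0).
  rewrite /lq -big_split; apply: ler_sum => i _ /=; rewrite [(x + v) i 0]mxE.
  have [x0|xi] := eqVneq (x i 0) 0; last exact: abs_powR_tangent.
  by move: (vx i); rewrite x0 normr0 normr_le0 => /eqP ->; rewrite addr0 normr0 addr0.
have -> : dot (free_grad f A lambda q x) v = dot (grad (psi f A) x) v + lambda *
   \sum_i (if x i 0 == 0 then 0 else q * Num.sg (x i 0) * `|x i 0| `^ (q - 1) * v i 0).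
  rewrite mulr_sumr -big_split; apply: eq_bigr => i _ /=; rewrite [free_grad _ _ _ _ _ _ _]mxE.
  have [x0|xi] := eqVneq (x i 0) 0; last by rewrite mulrDl !mulrA.
  by move: (vx i); rewrite x0 normr0 normr_le0 => /eqP ->; rewrite !mulr0 addr0.
have h3 := ler_wpM2l (ltW lambda_gt0) h2.
rewrite /F; move: h3; rewrite mulrDr; lra.
Qed.

(** The infinite slope of |t|^q at 0 makes every c a subgradient there; elsewhere c must be the
    derivative. *)
Lemma scalar_subgradient (x c e : R) : 0 < e ->
  (x != 0 -> c = lambda * q * Num.sg x * `|x| `^ (q - 1)) ->
  \forall t \near x,
    lambda * `|x| `^ q + c * (t - x) - e * `|t - x| <= lambda * `|t| `^ q.
Proof.
move=> e0 hc; have [->|x0] := eqVneq x 0.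
  have c1 : 0 < (`|c| + 1) / lambda.
    by rewrite divr_gt0// ltr_wpDl.
  (* The radius on which lambda |t|^(q-1) is at least |c| + 1. *)
  pose dlt := ((`|c| + 1) / lambda) `^ (q - 1)^-1.
  have d0 : 0 < dlt by rewrite powR_gt0.
  apply/nbhs_ballP; exists dlt => //= t; rewrite /ball /= sub0r normrN => td.
  rewrite normr0 powR0 ?gt_eqF// mulr0 add0r subr0.
  have [->|t0] := eqVneq t 0; first by rewrite normr0 !mulr0 powR0 ?gt_eqF// mulr0 subr0.
  have at0 : 0 < `|t| by rewrite normr_gt0.
  have q1 : q - 1 <= 0 by rewrite subr_le0 ltW.
  have := ler_npowR q1 at0 (ltW td).
  rewrite /dlt -powRrM mulVf ?powRr1 ?(ltW c1)//; last by rewrite subr_eq0 lt_eqF.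
  rewrite ler_pdivrMr// => h.
  rewrite (powR_pred q at0) mulrA [lambda * _]mulrC.
  apply: le_trans (ler_wpM2r (ltW at0) h).
  have := ler_norm (c * t); rewrite normrM.
  have := mulr_ge0 (ltW e0) (ltW at0); have := ltW at0; lra.
have d := is_derive_abs_powR q x0.
have el0 : 0 < e / lambda by rewrite divr_gt0.
have [dv dE] := d.
have : (fun h : R => h^-1 *: (((fun t : R => `|t| `^ q) \o shift x) (h *: 1) - `|x| `^ q)) @ 0^' -->
     q * Num.sg x * `|x| `^ (q - 1) by rewrite -dE; exact: dv.
move=> /cvgrPdist_le/(_ _ el0); rewrite /dnbhs /within => /nbhs_ballP[dlt /= d0 hd].
apply/nbhs_ballP; exists dlt => //= t; rewrite /ball /= distrC => tx.
have [->|tx0] := eqVneq t x; first by rewrite subrr normr0 !mulr0 addr0 subr0.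
have h0 : t - x != 0 by rewrite subr_eq0.
have := hd (t - x); rewrite /ball /= sub0r normrN => /(_ tx h0).
rewrite [(t - x) *: 1]mulr1 subrK (hc x0).
set P := `|x| `^ q; set T := `|t| `^ q; set D := q * _ * _.
rewrite /GRing.scale /= => h.
have ah : 0 < `|t - x| by rewrite normr_gt0.
have := ler_wpM2r (ltW ah) h; rewrite -normrM mulrBl.
have -> : (t - x)^-1 * (T - P) * (t - x) = T - P by rewrite mulrC mulrA divff ?mul1r.
move=> /(ler_wpM2l (ltW lambda_gt0)); rewrite mulrA [lambda * (e / lambda)]mulrC divfK ?gt_eqF// => h1.
have h2 : lambda * (D * (t - x) - (T - P)) <= e * `|t - x|.
  by apply: le_trans h1; rewrite ler_wpM2l ?(ltW lambda_gt0)// ler_norm.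
have -> : lambda * q * Num.sg x * `|x| `^ (q - 1) = lambda * D by rewrite /D !mulrA.
move: h2; lra.
Qed.

(** Off the support a zero entry asks the penalty to contribute the slope opposite to the gradient
    of [psi f A], and at 0 every slope is available. *)
Lemma free_grad_regular_subdiff x :
  regular_subdiff (EFin \o F f lambda q A) x (free_grad f A lambda q x).
Proof.
split=> // e e0.
have [L L0 hL] := psi_descent_cball A f_C2 (`|x| + 1).
pose c i := free_grad f A lambda q x i 0 - grad (psi f A) x i 0.
(* Half of e pays for the quadratic remainder of [psi f A], the other half is shared by the n
   coordinates; n + 1 keeps the denominator positive for n = 0. *)
pose e1 := e / (2 * (n%:R + 1)).
have n1 : 0 < n%:R + 1 :> R by rewrite ltr_wpDl.
have e10 : 0 < e1 by rewrite divr_gt0// mulr_gt0.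
have hc i : x i 0 != 0 -> c i = lambda * q * Num.sg (x i 0) * `|x i 0| `^ (q - 1).
  by move=> xi; rewrite /c [free_grad _ _ _ _ _ _ _]mxE (negPf xi) addrC addKr.
pose P (i : 'I_n) (y : 'cV[R]_n) := lambda * `|x i 0| `^ q + c i * (y i 0 - x i 0)
     - e1 * `|y i 0 - x i 0| <= lambda * `|y i 0| `^ q.
have sc : nbhs x (fun y => forall i, P i y).
  apply: (@filter_forall _ _ P (nbhs x) _) => i.
  exact: (@coord_continuous R n 1 i 0 x _ (scalar_subgradient e10 (hc i))).
have L1 : 0 < 2 * (L + 1) by have := L0; lra.
near=> y.
have yx1 : `|x - y| < 1.
  by near: y; apply/nbhs_ballP; exists 1 => //= y; rewrite -ball_normE.
have yxL : `|x - y| < e / (2 * (L + 1)).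
  near: y; apply/nbhs_ballP; exists (e / (2 * (L + 1))) => /=; first exact: divr_gt0.
  by move=> y; rewrite -ball_normE.
have yi : forall i, P i y by near: y.
rewrite -EFinD lee_fin /F.
have xr : `|x| <= `|x| + 1 by rewrite lerDl.
have yr : `|y| <= `|x| + 1.
  have -> : y = x - (x - y) by rewrite opprB addrC subrK.
  by apply: le_trans (ler_normB _ _) _; rewrite lerD2l ltW.
have := hL x y xr yr; rewrite ler_norml => /andP[h1 _].
have dE : `|y - x| = `|x - y| by rewrite distrC.
set t := `|y - x| in h1 dE *.
have t0 : 0 <= t by exact: normr_ge0.
have h2 : L * t ^+ 2 <= e / 2 * t.
  rewrite expr2 mulrA ler_wpM2r//.
  move: yxL; rewrite -dE ltr_pdivlMr// => h.
  by move: h t0; rewrite -/t; lra.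
have h3 : lambda * lq q x + \sum_i c i * (y i 0 - x i 0) - e / 2 * t <= lambda * lq q y.
  rewrite /lq !mulr_sumr -big_split /=.
  apply: (@le_trans _ _ (\sum_i (lambda * `|x i 0| `^ q + c i * (y i 0 - x i 0)
     - e1 * `|y i 0 - x i 0|))); last by apply: ler_sum => i _; exact: yi.
  rewrite sumrB lerD2l lerN2.
  apply: (@le_trans _ _ (\sum_(i < n) e1 * t)).
    apply: ler_sum => i _; rewrite ler_wpM2l ?(ltW e10)//.
    by have := coord_le_norm (y - x) i 0; rewrite !mxE.
  rewrite sumr_const card_ord -[leLHS]mulr_natl mulrA ler_wpM2r//.
  rewrite /e1; have -> : e / 2 = e / (2 * (n%:R + 1)) * (n%:R + 1).
    by field; rewrite gt_eqF.
  by rewrite mulrC ler_wpM2l ?(ltW e10)// lerDl.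
have h4 : dot (free_grad f A lambda q x) (y - x) =
   dot (grad (psi f A) x) (y - x) + \sum_i c i * (y i 0 - x i 0).
  rewrite -big_split; apply: eq_bigr => i _ /=.
  rewrite [(y - x) i 0]mxE [(- x) i 0]mxE /c; ring.
have h5 : e * t <= e * enorm (y - x) by rewrite ler_wpM2l ?norm_le_enorm// ltW.
rewrite h4; move: h1 h2 h3 h5; lra.
Unshelve. all: by end_near. Qed.

Lemma free_grad_limiting_subdiff x :
  limiting_subdiff (EFin \o F f lambda q A) x (free_grad f A lambda q x).
Proof.
split=> //; exists (fun=> x), (fun=> free_grad f A lambda q x).
split; [exact: cvg_cst|exact: cvg_cst| |exact: cvg_cst].
by move=> _; exact: free_grad_regular_subdiff.
Qed.

Lemma continuous_F : continuous (F f lambda q A).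
Proof.
move=> x; apply: (@cvgD _ _ _ (nbhs x)).
  by apply: differentiable_continuous; exact: differentiable_psi.
apply: (@cvgM _ _ (nbhs x)); first exact: cvg_cst.
exact: continuous_lq.
Qed.

Lemma F_level_bounded (cf K : R) : (forall z : 'cV[R]_m, cf <= f z) ->
  exists2 r, 0 <= r & forall x, F f lambda q A x <= K -> `|x| <= r.
Proof.
move=> hcf; exists (((K - cf) / lambda) `^ q^-1); first exact: powR_ge0.
move=> x FK; apply: norm_le_coord => [|i]; first exact: powR_ge0.
have h1 : lambda * `|x i 0| `^ q <= K - cf.
  apply: (@le_trans _ _ (lambda * lq q x)).
    by rewrite ler_wpM2l ?(ltW lambda_gt0)// lq_coord_le.
  by move: FK; rewrite /F /psi; have := hcf (A *m x); lra.
have h2 : `|x i 0| `^ q <= (K - cf) / lambda by rewrite ler_pdivlMr// mulrC.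
have -> : `|x i 0| = (`|x i 0| `^ q) `^ q^-1.
  by rewrite -powRrM divff ?gt_eqF// powRr1.
apply: ge0_ler_powR; rewrite ?nnegrE ?powR_ge0 ?invr_ge0 ?(ltW q_gt0)//.
by apply: le_trans h2; exact: powR_ge0.
Qed.

(** A trial parameter above 2L + alpha is always accepted, by the prox comparison with x and the
    descent lemma. The last rejected parameter is thus at most 2L + alpha, and the accepted one is
    tau times larger, unless the initial one was accepted. *)
Lemma prox_step_bounded (tau alpha mu_min mu_max r : R) :
  0 < mu_min -> 1 < tau -> 0 < alpha ->
  exists M, forall x mu xb mub, `|x| <= r -> mu_min <= mu <= mu_max ->
    prox_step f lambda q A tau alpha x mu xb mub -> mub <= M.
Proof.
move=> mm0 tau1 al0.
have [B B0 hB] := grad_psi_bounded A f_C2 r.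
have [s hs] := prox_grad_step_bound f A lambda_gt0 q_gt0_lt1 r mm0 B0.
have [L L0 hL] := psi_descent_cball A f_C2 (r + `|s|).
exists (Num.max mu_max (tau * (2 * L + alpha))) => x mu xb mub xr /andP[mu1 mu2].
case=> l [y [yP yN _ [_ ->]]]; rewrite le_max; apply/orP.
have tau0 : 0 < tau by lra.
have mu0 : 0 < mu by apply: lt_le_trans mu1.
case: l yP yN => [|l] yP yN; first by left; rewrite expr0 mul1r.
right; rewrite exprS -mulrA ler_pM2l// leNgt; apply/negP => hlt.
have nu1 : mu_min <= tau ^+ l * mu.
  by apply: le_trans mu1 _; rewrite ler_peMl ?(ltW mu0)// exprn_ege1// ltW.
have nu0 : 0 < tau ^+ l * mu by apply: lt_le_trans nu1.
have yl := yP l (leqnSn l); set nu := tau ^+ l * mu in nu1 nu0 hlt yl.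
have ysx := hs nu x (y l) nu1 xr (hB _ xr) yl.
have /negP := yN l (ltnSn l); apply.
move/(prox_gradP _ _ _ _ _ _ nu0)/(_ x) : yl.
have -> : enorm (x - x) ^+ 2 = 0 by rewrite subrr enorm0 expr0n.
have -> : dot (grad (psi f A) x) (x - x) = 0.
  by rewrite subrr /dot big1// => i _; rewrite [X in _ * X]mxE mulr0.
have sr : s <= `|s| by exact: ler_norm.
have xr' : `|x| <= r + `|s| by apply: le_trans xr _; rewrite lerDl.
have yr : `|y l| <= r + `|s|.
  rewrite -[y l](subrKC x); apply: le_trans (ler_normD _ _) _.
  by apply: lerD => //; apply: le_trans ysx sr.
have := hL x (y l) xr' yr; rewrite ler_norml => /andP[_ h1] h2.
have h3 : L * `|y l - x| ^+ 2 <= L * enorm (y l - x) ^+ 2.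
  by rewrite ler_wpM2l// ler_pXn2r ?nnegrE ?enorm_ge0// norm_le_enorm.
have h4 : 0 <= (nu - (2 * L + alpha)) * enorm (y l - x) ^+ 2.
  by rewrite mulr_ge0 ?sqr_ge0// subr_ge0 ltW.
rewrite /F; move: h1 h2 h3 h4; set E := enorm _ ^+ 2; lra.
Qed.

End Subgradients.

(** * From subvectors to R^n, and the Newton step *)

Section SupportReduction.
Context {R : realType} {m n : nat}.
Variables (f : 'cV[R]_m -> R) (A : 'M[R]_(m, n)) (lambda q : R).
Hypotheses (f_C2 : twice_continuously_differentiable f).
Hypotheses (lambda_gt0 : 0 < lambda) (q_gt0_lt1 : 0 < q < 1).
Implicit Types (S : {set 'I_n}) (x u v d : 'cV[R]_n).

Let q_gt0 : 0 < q. Proof. by case/andP: q_gt0_lt1. Qed.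
Let q_lt1 : q < 1. Proof. by case/andP: q_gt0_lt1. Qed.

Lemma sum_enum_val_supported S (g : 'I_n -> R) : (forall i, i \notin S -> g i = 0) ->
  \sum_(j < #|S|) g (enum_val j) = \sum_i g i.
Proof.
move=> g0; rewrite -(big_enum_val (A := mem S) g) /= [RHS](bigID (mem S)) /=.
by rewrite [X in _ + X]big1 ?addr0.
Qed.

Lemma dot_subvec S u v : (forall i, i \notin S -> v i 0 = 0) ->
  dot (subvec S u) (subvec S v) = dot u v.
Proof.
move=> v0; rewrite /dot -(@sum_enum_val_supported S (fun i => u i 0 * v i 0)) => [|i iS].
  by apply: eq_bigr => j _; rewrite !mxE.
by rewrite v0 ?mulr0.
Qed.

Lemma enorm_subvec S v : (forall i, i \notin S -> v i 0 = 0) ->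
  enorm (subvec S v) = enorm v.
Proof. by move=> v0; rewrite /enorm dot_subvec. Qed.

Lemma subcols_subvec S v : (forall i, i \notin S -> v i 0 = 0) ->
  subcols S A *m subvec S v = A *m v.
Proof.
move=> v0; apply/colP => k; rewrite !mxE.
rewrite -(@sum_enum_val_supported S (fun i => A k i * v i 0)) => [|i iS].
  by apply: eq_bigr => j _; rewrite !mxE.
by rewrite v0 ?mulr0.
Qed.

Lemma FS_subvec S v : (forall i, i \notin S -> v i 0 = 0) ->
  FS f lambda q A (subvec S v) = F f lambda q A v.
Proof.
move=> v0; rewrite /FS /F /psi subcols_subvec//; congr (_ + lambda * _).
rewrite /lq -(@sum_enum_val_supported S (fun i => `|v i 0| `^ q)) => [|i iS].
  by apply: eq_bigr => j _; rewrite !mxE.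
by rewrite v0 ?normr0 ?powR0// gt_eqF.
Qed.

Lemma supp_out x i : i \notin supp x -> x i 0 = 0.
Proof. by rewrite in_supp negbK => /eqP. Qed.

Lemma free_grad_out x i : i \notin supp x -> free_grad f A lambda q x i 0 = 0.
Proof. by move=> /supp_out x0; rewrite mxE x0 eqxx. Qed.

Lemma rvecE x : rvec f lambda q A x = subvec (supp x) (free_grad f A lambda q x).
Proof.
apply/colP => j; have xj : x (enum_val j) 0 != 0 by rewrite -in_supp enum_valP.
rewrite [RHS]mxE /rvec /FS grad_F//; last by rewrite mxE.
rewrite /free_grad [LHS]mxE [RHS]mxE [subvec _ _ _ _]mxE (negPf xj); congr (_ + _).
rewrite -[LHS]dot_delta -[RHS]dot_delta !dot_grad_psi// subcols_subvec; last exact: supp_out.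
congr dot; apply/colP => k.
by rewrite -!colE !mxE.
Qed.

Lemma enorm_rvec x : enorm (rvec f lambda q A x) = enorm (free_grad f A lambda q x).
Proof. by rewrite rvecE enorm_subvec//; exact: free_grad_out. Qed.

Lemma dot_rvec x d : dot (rvec f lambda q A x) (subvec (supp x) d) =
  dot (free_grad f A lambda q x) d.
Proof. by rewrite rvecE dotC dot_subvec 1?dotC//; exact: free_grad_out. Qed.

Lemma subvecDZ S x d (t : R) : subvec S x + t *: subvec S d = subvec S (x + t *: d).
Proof. by apply/colP => j; rewrite !mxE. Qed.

(** Every real eigenvalue is bounded by the operator bound for the sup norm. If there is none, [inf]
    of the empty set is 0, which agrees with the bound. *)
Lemma lambda_min_ge p (M : 'M[R]_p) (C : R) : 0 <= C ->
  (forall i j, `|M i j| <= C) -> - (p%:R * C) <= lambda_min M.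
Proof.
move=> C0 hM; rewrite /lambda_min.
have [[a ev]|] := pselect (exists a, eigenvalue M a); last first.
  move=> h; rewrite (_ : mkset _ = set0) ?inf0 ?oppr_le0 ?mulr_ge0//.
  by apply/seteqP; split => // a ev; apply: h; exists a.
apply: lb_le_inf; first by exists a.
move=> {ev} b /= /eigenvalueP[v vM v0].
have : `|b| * `|v^T| <= p%:R * C * `|v^T|.
  have e : M^T *m v^T = b *: v^T by rewrite -trmx_mul vM linearZ.
  rewrite -normrZ -e.
  by apply: mulmx_norm_le => // i j; rewrite mxE.
rewrite ler_pM2r; last by rewrite normr_gt0 trmx_eq0.
by rewrite ler_norml => /andP[].
Qed.

Lemma free_grad_bounded (r nu : R) : 0 < nu ->
  exists2 B, 0 <= B & forall x, `|x| <= r -> (forall i, x i 0 != 0 -> nu <= `|x i 0|) ->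
    enorm (free_grad f A lambda q x) <= B.
Proof.
move=> nu0; have [B B0 hB] := grad_psi_bounded A f_C2 r.
have P0 : 0 <= B + lambda * q * nu `^ (q - 1).
  by rewrite addr_ge0// !mulr_ge0 ?powR_ge0 ?(ltW lambda_gt0) ?(ltW q_gt0).
exists (n%:R * (B + lambda * q * nu `^ (q - 1))); first exact: mulr_ge0.
move=> x xr xnu; apply: le_trans (enorm_le_norm _) _; rewrite ler_wpM2l//.
apply: norm_le_coord => // i; rewrite mxE; have [_|xi] := eqVneq; first by rewrite normr0.
apply: le_trans (ler_normD _ _) _; apply: lerD.
  by apply: le_trans (coord_le_norm _ _ _) (hB _ xr).
rewrite !normrM normr_sg xi mulr1 (gtr0_norm lambda_gt0) (gtr0_norm q_gt0).
rewrite ger0_norm ?powR_ge0// ler_wpM2l// ?mulr_ge0 ?(ltW lambda_gt0) ?(ltW q_gt0)//.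
by apply: ler_npowR (xnu _ xi); rewrite ?subr_le0 ?(ltW q_lt1).
Qed.

(** With G d = -r, an upper bound on G becomes a lower bound on d in terms of the residual; descent
    along d comes from the angle condition. *)
Lemma Gmat_bounded (r nu sigma b1 b2 : R) : 0 <= r -> 0 < nu -> 0 < sigma -> 0 < b1 -> 0 < b2 ->
  exists2 C, 0 <= C & forall x, `|x| <= r -> (forall i, x i 0 != 0 -> nu <= `|x i 0|) ->
    forall i j, `|Gmat f lambda q A sigma b1 b2 x i j| <= C.
Proof.
move=> r0 nu0 s0 b10 b20.
have [C C0 hC] := @hess_F_bounded _ _ f lambda q f_C2 lambda_gt0 q_gt0_lt1 n `|A| r nu (normr_ge0 _) r0 nu0.
have [B B0 hB] := free_grad_bounded r nu0.
exists (C + (b1 * (n%:R * C) + b2 * B `^ sigma)).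
  by rewrite !addr_ge0// mulr_ge0 ?mulr_ge0 ?powR_ge0 ?(ltW b10) ?(ltW b20).
move=> x xr xnu i j; rewrite mxE; apply: le_trans (ler_normD _ _) _.
have Sn : (#|supp x| <= n)%N by rewrite -[n in (_ <= n)%N]card_ord max_card.
have hH k l : `|Hmat f lambda q A x k l| <= C.
  apply: hC => //.
  - by move=> a b; rewrite mxE coord_le_norm.
  - by apply: norm_le_coord => // a; rewrite mxE; apply: le_trans xr; exact: coord_le_norm.
  - by move=> a; rewrite mxE; apply: xnu; rewrite -in_supp enum_valP.
apply: lerD => //; rewrite mxE.
have z0 : 0 <= zeta f lambda q A x by rewrite le_max lexx orbT.
have zC : zeta f lambda q A x <= n%:R * C.
  rewrite ge_max mulr_ge0// andbT lerNl.
  apply: le_trans (lambda_min_ge C0 hH); rewrite lerN2 ler_wpM2r// ler_nat//.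
have rB : enorm (rvec f lambda q A x) `^ sigma <= B `^ sigma.
  by apply: ge0_ler_powR; rewrite ?nnegrE ?enorm_ge0 ?(ltW s0)// enorm_rvec hB.
have h1 := ler_wpM2l (ltW b10) zC; have h2 := ler_wpM2l (ltW b20) rB.
have p1 := mulr_ge0 (ltW b10) z0.
have p2 := mulr_ge0 (ltW b20) (powR_ge0 (enorm (rvec f lambda q A x)) sigma).
case: (i == j); rewrite ?mulr1n ?mulr0n ?normr0.
  by rewrite ger0_norm; lra.
lra.
Qed.

(** Three cases bound the step from below. A full step satisfies |d| >= |r| / (n^2 C + 1) because G
    d = -r. Otherwise the preceding trial t d was rejected. If t |d| >= nu, the step has length at
    least a = beta nu. If not, the trial changes no sign, the descent lemma applies, and the failed
    Armijo test gives (1 - varrho) c |r| <= (L + 1) t |d|. *)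
Lemma newton_step_bound (r nu sigma varrho beta b1 b2 c : R) :
  0 <= r -> 0 < nu -> 0 < sigma -> 0 < varrho < 1 / 2 -> 0 < beta < 1 ->
  0 < b1 -> 0 < b2 -> 0 < c ->
  exists a b, [/\ 0 < a, 0 < b & forall x d x',
    `|x| <= r -> (forall i, x i 0 != 0 -> nu <= `|x i 0|) ->
    newton_step f lambda q A sigma varrho beta b1 b2 x d x' ->
    c <= descent_cosine f lambda q A x d ->
    let e := enorm (free_grad f A lambda q x) in
    [/\ F f lambda q A x' <= F f lambda q A x - varrho * c * e * enorm (x' - x),
        Num.min a (b * e) <= enorm (x' - x), 0 < e,
        0 < enorm (x' - x) & forall i, x i 0 = 0 -> x' i 0 = 0]].
Proof.
move=> r0 nu0 s0 /andP[vr0 vr1] /andP[be0 be1] b10 b20 c0.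
have [C C0 hC] := Gmat_bounded r0 nu0 s0 b10 b20.
(* The radius r + nu contains every trial point x + t d with t |d| < nu, the only trials to which
   the descent lemma is applied. *)
have [L L0 hL] := F_free_descent A f_C2 lambda_gt0 q_gt0_lt1 (r + nu).
have K0 : 0 < n%:R * (n%:R * C) + 1 by rewrite ltr_wpDl// !mulr_ge0.
have L1 : 0 < L + 1 by rewrite ltr_wpDl.
have vr2 : 0 < 1 - varrho by lra.
exists (beta * nu), (Num.min (n%:R * (n%:R * C) + 1)^-1 (beta * ((1 - varrho) * c) / (L + 1))).
split; first exact: mulr_gt0.
  by rewrite lt_min invr_gt0 K0 divr_gt0// !mulr_gt0.
move=> x d x' xr xnu [Gd dout [j [arm narm x'E]]] hcos e.
have e_ge0 : 0 <= e by exact: enorm_ge0.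
have ed_ge0 : 0 <= enorm d by exact: enorm_ge0.
move: hcos; rewrite /descent_cosine dot_rvec enorm_rvec enorm_subvec// -/e => hcos.
(* Division by zero yields 0, so a positive cosine forces both norms to be nonzero. *)
have [e0 d0] : 0 < e /\ 0 < enorm d.
  rewrite !lt0r e_ge0 ed_ge0 !andbT; apply/andP; rewrite -negb_or -mulf_eq0.
  by apply/eqP => h; move: hcos; rewrite h invr0 mulr0 leNgt c0.
have hdot : c * (e * enorm d) <= - dot (free_grad f A lambda q x) d.
  by rewrite -ler_pdivlMr// mulr_gt0.
have bj0 : 0 < beta ^+ j by rewrite exprn_gt0.
have x'x : x' - x = beta ^+ j *: d by rewrite x'E addrAC subrr add0r.
have enx : enorm (x' - x) = beta ^+ j * enorm d by rewrite x'x enormZ gtr0_norm.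
have sup0 t i : i \notin supp x -> (x + t *: d) i 0 = 0.
  by move=> iS; rewrite !mxE dout// supp_out// mulr0 addr0.
split=> //.
- move: arm; rewrite /armijo subvecDZ !FS_subvec ?dot_rvec; [|exact: supp_out|exact: sup0].
  rewrite -x'E enx => h; apply: le_trans h _; rewrite lerD2l.
  have := ler_wpM2l (ltW (mulr_gt0 vr0 bj0)) hdot; lra.
- rewrite enx; case: j arm narm x'E bj0 x'x enx => [|j] arm narm x'E bj0 x'x enx.
    rewrite ge_min; apply/orP; right; rewrite expr0 mul1r.
    apply: (@le_trans _ _ ((n%:R * (n%:R * C) + 1)^-1 * e)).
      by rewrite ler_wpM2r// ge_min lexx.
    rewrite mulrC ler_pdivrMr// /e -enorm_rvec.
    apply: (@le_trans _ _ (n%:R * (n%:R * C) * enorm d)); last by rewrite mulrC ler_wpM2l// lerDl.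
    rewrite -[rvec _ _ _ _ _]opprK -Gd.
    have Sn : (#|supp x| <= n)%N by rewrite -[n in (_ <= n)%N]card_ord max_card.
    apply: le_trans (enorm_le_norm _) _; rewrite normrN -mulrA.
    apply: ler_pM => //; first by rewrite ler_nat.
    apply: le_trans (mulmx_norm_le _ C0 (hC x xr xnu)) _.
    apply: ler_pM => //; rewrite ?mulr_ge0//; first by rewrite ler_wpM2r// ler_nat.
    by rewrite -(enorm_subvec dout) norm_le_enorm.
  set t := beta ^+ j; have t0 : 0 < t by rewrite exprn_gt0.
  have exprE : beta ^+ j.+1 = beta * t by rewrite exprS.
  have [tn|tn] := leP nu (t * `|d|).
    rewrite ge_min; apply/orP; left; rewrite exprE -mulrA ler_pM2l//.
    by apply: le_trans tn _; rewrite ler_pM2l// norm_le_enorm.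
  rewrite ge_min; apply/orP; right.
  have /negP := narm j (ltnSn j); rewrite /armijo subvecDZ !FS_subvec ?dot_rvec; [|exact: supp_out|exact: sup0].
  rewrite -/t => /negP; rewrite -ltNge => na.
  have tdn : `|t *: d| <= nu by rewrite normrZ gtr0_norm// ltW.
  have := hL x (t *: d) _ _ _; rewrite normrZ (gtr0_norm t0).
  have xr' : `|x| <= r + nu by apply: le_trans xr _; rewrite lerDl ltW.
  have xdr : `|x + t *: d| <= r + nu by apply: le_trans (ler_normD _ _) _; exact: lerD.
  have tdi i : `|(t *: d) i 0| <= `|x i 0|.
    have [xi|xi] := eqVneq (x i 0) 0.
      by rewrite mxE dout ?mulr0 ?normr0// in_supp xi eqxx.
    by apply: le_trans (coord_le_norm _ _ _) (le_trans tdn (xnu _ xi)).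
  move=> /(_ xr' xdr tdi); rewrite dotZr => h.
  set D := dot (free_grad f A lambda q x) d in na h hdot *.
  have h1 : (1 - varrho) * - D * t < L * (t * `|d|) * `|d| * t.
    by move: na h; set F1 := F _ _ _ _ (_ + _); set F2 := F _ _ _ _ x; lra.
  have {}h1 : (1 - varrho) * - D < L * (t * `|d|) * `|d| by rewrite ltr_pM2r in h1.
  have h2 : (1 - varrho) * (c * (e * enorm d)) <= (1 - varrho) * - D by rewrite ler_pM2l.
  have h3 : L * (t * `|d|) * `|d| <= (L + 1) * (t * enorm d) * enorm d.
    apply: ler_pM; rewrite ?mulr_ge0 ?(ltW t0) ?norm_le_enorm//.
    apply: ler_pM; rewrite ?mulr_ge0 ?(ltW t0) ?lerDl//.
    by rewrite ler_pM2l// norm_le_enorm.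
  have h4 : (1 - varrho) * c * e <= (L + 1) * (t * enorm d).
    rewrite -(ler_pM2r d0); lra.
  apply: (@le_trans _ _ (beta * ((1 - varrho) * c) / (L + 1) * e)).
    by rewrite ler_wpM2r// ge_min lexx orbT.
  rewrite mulrAC ler_pdivrMr// exprE.
  have := ler_wpM2l (ltW be0) h4; lra.
- by rewrite enx mulr_gt0.
- by move=> i xi; rewrite x'E sup0// in_supp xi eqxx.
Qed.

End SupportReduction.

(** * Convergence from the Kurdyka-Lojasiewicz inequality *)

Section KLDescent.
Context {R : realType}.

(** Concavity compares the chord from t to s with difference quotients at t, so differentiability is
    used at t only and s may be the endpoint 0. *)
Lemma desingularizing_tangent (eta : \bar R) (phi : R -> R) (s t : R) :
  desingularizing eta phi -> 0 <= s -> (s%:E < eta)%E -> 0 < t -> (t%:E < eta)%E ->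
  phi s <= phi t + derive1 phi t * (s - t).
Proof.
case=> _ conc _ der _ s0 se t0 te.
have [->|st] := eqVneq s t; first by rewrite subrr mulr0 addr0.
have [dphi _] := der t (conj t0 te).
apply/ler_addgt0Pr => e e0.
have as0 : 0 < `|s - t| by rewrite normr_gt0 subr_eq0.
have ees : 0 < e / `|s - t| by rewrite divr_gt0.
have : (fun h : R => h^-1 *: ((phi \o shift t) (h *: 1) - phi t)) @ 0^' --> derive1 phi t.
  by rewrite derive1E; exact: dphi.
move=> /cvgrPdist_le/(_ _ ees); rewrite /dnbhs /within => /nbhs_ballP[dlt /= d0 hd].
pose a := Num.min (1 / 2) (dlt / 2 / `|s - t|).
have a0 : 0 < a by rewrite lt_min !divr_gt0.
have a1 : a <= 1 by rewrite ge_min; apply/orP; left; lra.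
have ad : a * `|s - t| < dlt.
  apply: (@le_lt_trans _ _ (dlt / 2)); last lra.
  by rewrite -ler_pdivlMr// ge_min lexx orbT.
have h0 : a * (s - t) != 0 by rewrite mulf_neq0 ?subr_eq0// gt_eqF.
have := hd (a * (s - t)); rewrite /ball /= sub0r normrN normrM (gtr0_norm a0) => /(_ ad h0).
rewrite [(a * (s - t)) *: 1]mulr1.
have a01 : 0 <= a <= 1 by rewrite (ltW a0).
have cv := conc s t a (conj s0 se) (conj (ltW t0) te) a01.
have arg : a * (s - t) + t = a * s + (1 - a) * t by ring.
rewrite arg; move: cv; set X := phi (_ + _); set p := phi s; set o := phi t; set D := derive1 phi t.
move=> cv /(ler_wpM2r (normr_ge0 (a * (s - t)))); rewrite /GRing.scale /= -normrM mulrBl.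
have -> : (a * (s - t))^-1 * (X - o) * (a * (s - t)) = X - o by rewrite mulrAC mulVf// mul1r.
have -> : e / `|s - t| * `|a * (s - t)| = a * e.
  by rewrite normrM (gtr0_norm a0); field; rewrite gt_eqF.
rewrite ler_norml => /andP[h _].
rewrite -(ler_pM2l a0); lra.
Qed.

Lemma desingularizing_cvg0 (eta : \bar R) (phi : R -> R) (e : R) :
  (0 < eta)%E -> desingularizing eta phi -> 0 < e ->
  exists2 dlt, 0 < dlt & forall s, 0 <= s -> s < dlt -> (s%:E < eta)%E -> phi s <= e.
Proof.
move=> eta0 [[cphi _] _ phi0 _ _] e0.
have /subspace_continuousP/(_ 0 (conj (lexx 0) eta0)) := cphi.
move=> /cvgrPdist_le/(_ _ e0); rewrite /within => /nbhs_ballP[dlt /= d0 hd].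
exists dlt => // s s0 sd se; have := hd s.
rewrite /ball /= sub0r normrN ger0_norm// => /(_ sd (conj s0 se)).
by rewrite /from_subspace phi0 sub0r normrN; apply: le_trans; exact: ler_norm.
Qed.

(* |x_k - xs| + Phi_k / kappa is nonincreasing while x_k stays in the ball, so
   the iterates never leave it. *)
Lemma ball_trapping (V : normedZmodType R) (x : nat -> V) (xs : V) (Phi D : nat -> R)
    (kappa dlt : R) (N : nat) :
  0 < kappa -> 0 < dlt ->
  (forall k, (N <= k)%N -> `|x k.+1 - x k| <= D k) ->
  (forall k, (N <= k)%N -> 0 <= Phi k) ->
  (forall k, (N <= k)%N -> `|x k - xs| < dlt -> kappa * D k <= Phi k - Phi k.+1) ->
  (forall e, 0 < e -> exists M, forall k, (M <= k)%N -> Phi k <= e) ->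
  (forall e M, 0 < e -> exists2 k, (M <= k)%N & `|x k - xs| < e) ->
  exists M, forall k, (M <= k)%N ->
    [/\ `|x k - xs| < dlt, kappa * D k <= Phi k - Phi k.+1 & `|x k - xs| <= Phi k / kappa].
Proof.
move=> k0 d0 hD hP hdec hP0 hcl.
(* With Phi_K / kappa <= dlt/4 and x_K within dlt/2 of xs, the monitored sum starts below dlt. *)
have [M hM] := hP0 (kappa * dlt / 4) ltac:(by rewrite divr_gt0// mulr_gt0).
have [K KM Kd] := hcl (dlt / 2) (maxn M N) ltac:(by rewrite divr_gt0).
have MK : (M <= K)%N := leq_trans (leq_maxl _ _) KM.
have NK : (N <= K)%N := leq_trans (leq_maxr _ _) KM.
have step k : (N <= k)%N -> `|x k - xs| < dlt ->
    `|x k.+1 - xs| + Phi k.+1 / kappa <= `|x k - xs| + Phi k / kappa.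
  move=> Nk xd; have h1 := hdec k Nk xd; have h2 := hD k Nk.
  have h3 : D k <= Phi k / kappa - Phi k.+1 / kappa.
    by rewrite -mulrBl ler_pdivlMr// mulrC.
  have := ler_distD (x k) (x k.+1) xs; lra.
have inv j : `|x (K + j)%N - xs| + Phi (K + j)%N / kappa < dlt.
  elim: j => [|j IH].
    rewrite addn0; have : Phi K / kappa <= dlt / 4.
      by rewrite ler_pdivrMr//; have := hM K MK; lra.
    lra.
  have Nj : (N <= K + j)%N := leq_trans NK (leq_addr _ _).
  have P0 : 0 <= Phi (K + j)%N / kappa by rewrite divr_ge0 ?hP// ltW.
  have xd : `|x (K + j)%N - xs| < dlt by lra.
  by rewrite addnS; apply: le_lt_trans (step _ Nj xd) IH.
have inb k : (K <= k)%N -> `|x k - xs| < dlt.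
  move=> Kk; have Nk := leq_trans NK Kk; have P0 : 0 <= Phi k / kappa by rewrite divr_ge0 ?hP// ltW.
  by have := inv (k - K)%N; rewrite subnKC//; lra.
have mono k j : (K <= k)%N ->
    `|x (k + j)%N - x k| + Phi (k + j)%N / kappa <= Phi k / kappa.
  move=> Kk; elim: j => [|j IH]; first by rewrite addn0 subrr normr0 add0r.
  have Nj : (N <= k + j)%N := leq_trans NK (leq_trans Kk (leq_addr _ _)).
  have h1 := hdec _ Nj (inb _ (leq_trans Kk (leq_addr _ _))); have h2 := hD _ Nj.
  have h3 : D (k + j)%N <= Phi (k + j)%N / kappa - Phi (k + j).+1 / kappa.
    by rewrite -mulrBl ler_pdivlMr// mulrC.
  rewrite addnS; have := ler_distD (x (k + j)%N) (x (k + j).+1) (x k); lra.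
exists K => k Kk; split; first exact: inb.
  by apply: hdec; [exact: leq_trans NK Kk|exact: inb].
(* The path from x_k to a later iterate within e of xs has length at most Phi_k / kappa, so the
   distance to xs exceeds this by at most e. *)
apply/ler_addgt0Pr => e e0; have [j kj je] := hcl e k e0.
have := mono k (j - k)%N Kk; rewrite subnKC//.
have P0 : 0 <= Phi j / kappa.
  by rewrite divr_ge0 ?(ltW k0)// hP//; exact: leq_trans NK (leq_trans Kk kj).
have := ler_distD (x j) (x k) xs; rewrite (distrC (x k) (x j)); lra.
Qed.

(** The point xs is only assumed to be approached infinitely often, and trapping upgrades this to
    convergence. With e_k = h(x_k) - h(xs), the tangent of phi at e_k gives phi(e_k) - phi(e_(k+1))
    >= phi'(e_k) (e_k - e_(k+1)), and phi'(e_k) |g(x_k)| >= 1 absorbs the residual in the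
    decrease. *)
Lemma kl_descent n (h : 'cV[R]_n -> R) (g : 'cV[R]_n -> 'cV[R]_n) (xs : 'cV[R]_n)
    (phi : R -> R) (x : nat -> 'cV[R]_n) (kappa : R) (N : nat) :
  0 < kappa ->
  (forall y, limiting_subdiff (EFin \o h) y (g y)) ->
  KL_with (EFin \o h) xs phi ->
  (forall k, (N <= k)%N ->
     h (x k.+1) <= h (x k) - kappa * enorm (g (x k)) * enorm (x k.+1 - x k)) ->
  (forall k, (N <= k)%N -> h xs < h (x k)) ->
  (forall e, 0 < e -> exists M, forall k, (M <= k)%N -> h (x k) < h xs + e) ->
  (forall e M, 0 < e -> exists2 k, (M <= k)%N & `|x k - xs| < e) ->
  x @ \oo --> xs /\ exists M, forall k, (M <= k)%N ->
    [/\ kappa * enorm (x k.+1 - x k) <= phi (h (x k) - h xs) - phi (h (x k.+1) - h xs),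
        0 <= phi (h (x k) - h xs),
        `|x k - xs| <= phi (h (x k) - h xs) / kappa
      & 1 <= derive1 phi (h (x k) - h xs) * enorm (g (x k))].
Proof.
move=> k0 hg [_ [eta [U [eta0 Uxs des hKL]]]] hdec hgt hlim hcl.
have [dlt d0 hU] : exists2 d, 0 < d & forall y, `|y - xs| < d -> U y.
  have /nbhs_ballP[d d0 hd] := Uxs; exists d => // y yd; apply: hd.
  by rewrite -ball_normE /= distrC.
(* Since eta may be infinite, a real threshold is extracted for use with the limit of the values. *)
have [eta' eta'0 heta] : exists2 r : R, 0 < r & forall s, s < r -> (s%:E < eta)%E.
  move: eta0; case: (eta) => [r|_|//]; last by exists 1 => // s _; rewrite ltry.
  by rewrite lte_fin => r0; exists r.
have [M1 hM1] := hlim _ eta'0.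
pose e k := h (x k) - h xs.
have e0 k : (N <= k)%N -> 0 < e k by move=> /hgt; rewrite subr_gt0.
have ee k : (M1 <= k)%N -> ((e k)%:E < eta)%E.
  by move=> /hM1 hk; apply: heta; rewrite /e; lra.
pose N1 := maxn N M1.
have NN1 k : (N1 <= k)%N -> (N <= k)%N by exact: leq_trans (leq_maxl _ _).
have MN1 k : (N1 <= k)%N -> (M1 <= k)%N by exact: leq_trans (leq_maxr _ _).
have phige0 k : (N1 <= k)%N -> 0 <= phi (e k).
  case: des => -[_ p0] _ _ _ _ kN; apply: p0; split; last exact/ee/MN1.
  exact/ltW/e0/NN1.
have kl k : (N1 <= k)%N -> `|x k - xs| < dlt -> 1 <= derive1 phi (e k) * enorm (g (x k)).
  move=> kN /hU Ux; have := hKL _ Ux.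
  rewrite /= lte_fin => /(_ (hgt _ (NN1 _ kN))).
  have -> : ((h (x k))%:E < (h xs)%:E + eta)%E.
    have := ee _ (MN1 _ kN); case: (eta) => [r||].
    - by rewrite -EFinD !lte_fin /e; lra.
    - by move=> _; rewrite addey// ltry.
    - by [].
  move=> /(_ isT); rewrite /= -/(e k) => hk.
  have dpos : 0 < derive1 phi (e k).
    by case: des => _ _ _ _; apply; split; [exact/e0/NN1|exact/ee/MN1].
  rewrite -lee_fin EFinM; apply: le_trans hk _.
  rewrite lee_pmul2l// ?lte_fin//; apply: ereal_inf_lbound.
  by exists (g (x k)).
have dec k : (N1 <= k)%N -> `|x k - xs| < dlt ->
    kappa * enorm (x k.+1 - x k) <= phi (e k) - phi (e k.+1).
  move=> kN xd; have h1 := kl _ kN xd.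
  have kN' : (N1 <= k.+1)%N := leq_trans kN (leqnSn k).
  have h2 := desingularizing_tangent des (ltW (e0 _ (NN1 _ kN'))) (ee _ (MN1 _ kN'))
     (e0 _ (NN1 _ kN)) (ee _ (MN1 _ kN)).
  have h3 := hdec _ (NN1 _ kN).
  have dpos : 0 < derive1 phi (e k).
    by case: des => _ _ _ _; apply; split; [exact/e0/NN1|exact/ee/MN1].
  have h4 : kappa * enorm (g (x k)) * enorm (x k.+1 - x k) <= e k - e k.+1.
    by rewrite /e; lra.
  have h5 := ler_wpM2l (ltW dpos) h4.
  have h6 : 0 <= kappa * enorm (x k.+1 - x k) by rewrite mulr_ge0 ?enorm_ge0// ltW.
  have h7 := ler_wpM2r h6 h1.
  lra.
have hP0 r : 0 < r -> exists M, forall k, (M <= k)%N -> phi (e k) <= r.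
  move=> r0; have [d1 d10 hd1] := desingularizing_cvg0 eta0 des r0.
  have [M2 hM2] := hlim _ d10; exists (maxn N1 M2) => k; rewrite geq_max => /andP[kN kM].
  apply: hd1; [exact/ltW/e0/NN1| |exact/ee/MN1].
  by have := hM2 _ kM; rewrite /e; lra.
have [M hM] := @ball_trapping _ x xs (fun k => phi (e k)) (fun k => enorm (x k.+1 - x k))
  kappa dlt N1 k0 d0 (fun k _ => norm_le_enorm _) phige0 dec hP0 hcl.
split.
  apply/cvgrPdist_le => r r0; have [M' hM'] := hP0 (kappa * r) (mulr_gt0 k0 r0).
  exists (maxn M M') => // k /=; rewrite geq_max => /andP[/hM[_ _ hk] /hM' hk'].
  by rewrite distrC; apply: le_trans hk _; rewrite ler_pdivrMr// mulrC.
exists (maxn M N1) => k; rewrite geq_max => /andP[kM kN].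
have [h1 h2 h3] := hM _ kM.
by split=> //; [exact: phige0|exact: kl].
Qed.

Lemma derive1_scaled_sqrt (c s : R) : 0 < s ->
  derive1 (fun t => c * Num.sqrt t) s = c / (2 * Num.sqrt s).
Proof.
move=> s0; rewrite derive1E (@deriveZ _ _ _ Num.sqrt c s 1).
  by rewrite derive_sqrt.
exact: @ex_derive _ _ _ _ _ _ _ (is_derive1_sqrt s0).
Qed.

End KLDescent.

(** * Monotone sequences, geometric bounds and telescoping series *)

Section Sequences.
Context {R : realType}.

Lemma nat_nonincreasing_eventually_constant (u : nat -> nat) (M : nat) :
  (forall k, (M <= k)%N -> (u k.+1 <= u k)%N) ->
  exists N, forall k, (N <= k)%N -> u k.+1 = u k.
Proof.
move: {2}(u M) (leqnn (u M)) => b; elim: b M => [|b IH] M uM mono.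
  exists M => k Mk; have : (u k <= 0)%N; last first.
    by rewrite leqn0 => /eqP uk; have := mono k Mk; rewrite uk leqn0 => /eqP.
  apply: leq_trans uM; elim: k Mk => [|k IHk]; first by rewrite leqn0 => /eqP ->.
  by rewrite leq_eqVlt => /predU1P[->//|Mk]; apply: leq_trans (mono k Mk) (IHk Mk).
have [h|/existsNP[k /not_implyP[Mk /eqP uk]]] :=
  pselect (forall k, (M <= k)%N -> u k.+1 = u k); first by exists M.
apply: (IH k.+1) => [|j kj]; last by apply: mono; exact: leq_trans Mk (ltnW kj).
have uMk : (u k <= u M)%N.
  elim: k Mk {uk} => [|k IHk]; first by rewrite leqn0 => /eqP ->.
  by rewrite leq_eqVlt => /predU1P[->//|Mk]; apply: leq_trans (mono k Mk) (IHk Mk).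
by rewrite -ltnS; apply: leq_trans uM; apply: leq_trans uMk; rewrite ltn_neqAle uk mono.
Qed.

Lemma eventually_nonincreasing_cvg (u : nat -> R) (N : nat) (lb : R) :
  (forall k, (N <= k)%N -> u k.+1 <= u k) -> (forall k, lb <= u k) ->
  exists2 l, forall k, (N <= k)%N -> l <= u k
    & forall e, 0 < e -> exists M, forall k, (M <= k)%N -> u k < l + e.
Proof.
move=> mono lbu; pose v k := u (k + N)%N.
have vmono : nonincreasing_seq v.
  by apply/nonincreasing_seqP => k; rewrite /v addSn; apply: mono; rewrite leq_addl.
have vlb : has_lbound (range v) by exists lb => _ [k _ <-]; exact: lbu.
have vcvg := nonincreasing_cvgn vmono vlb; set l := inf _ in vcvg.
have lv k : l <= v k by apply: ge_inf => //; exists k.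
exists l => [k Nk|e e0]; first by have := lv (k - N)%N; rewrite /v subnK.
have /cvgrPdist_lt/(_ _ e0)[M _ hM] := vcvg.
exists (M + N)%N => k Mk; have := hM (k - N)%N; rewrite /= leq_subRL; last first.
  by apply: leq_trans Mk; rewrite leq_addl.
rewrite addnC => /(_ Mk); rewrite /v subnK; last by apply: leq_trans Mk; rewrite leq_addl.
by rewrite ltr_norml => /andP[h _]; lra.
Qed.

(** R-linear convergence is required from index 0 on, so the finitely many early terms are absorbed
    in the constant; S dominates each ratio u_i / rho^i with i < K. *)
Lemma geometric_bound_from (u : nat -> R) (K : nat) (C rho : R) :
  0 < rho -> 0 <= C -> (forall k, 0 <= u k) ->
  (forall k, (K <= k)%N -> u k <= C * rho ^+ k) ->
  exists2 c, 0 < c & forall k, u k <= c * rho ^+ k.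
Proof.
move=> r0 C0 u0 hu; pose S := \sum_(i < K) u i / rho ^+ i.
have t0 i : 0 <= u i / rho ^+ i by rewrite divr_ge0// exprn_ge0// ltW.
have S0 : 0 <= S by apply: sumr_ge0 => i _; exact: t0.
exists (S + C + 1); first by lra.
move=> k; have rk : 0 < rho ^+ k by rewrite exprn_gt0.
have [Kk|kK] := leqP K k.
  by apply: le_trans (hu k Kk) _; rewrite ler_pM2r//; lra.
rewrite -ler_pdivrMr//; apply: (@le_trans _ _ S); last by lra.
rewrite /S (bigD1 (Ordinal kK))//= lerDl; apply: sumr_ge0 => i _; exact: t0.
Qed.

Lemma nneseries_lty_telescope (D P : nat -> R) (M : nat) (kappa : R) : 0 < kappa ->
  (forall k, 0 <= D k) -> (forall k, (M <= k)%N -> 0 <= P k) ->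
  (forall k, (M <= k)%N -> kappa * D k <= P k - P k.+1) ->
  (\sum_(1 <= k <oo) (D k)%:E < +oo)%E.
Proof.
move=> k0 D0 P0 hD; pose T n := \sum_(1 <= k < n) D k.
(* Starting at M + 1 ensures n >= 1, as splitting off the last term of a sum from 1 requires. *)
have hT n : (M.+1 <= n)%N -> T n + P n / kappa <= T M.+1 + P M.+1 / kappa.
  elim: n => [//|n IH]; rewrite leq_eqVlt => /predU1P[[->]//|]; rewrite ltnS => Mn.
  apply: le_trans (IH Mn); rewrite /T big_nat_recr /=; last exact: leq_trans Mn.
  have : D n <= P n / kappa - P n.+1 / kappa.
    by rewrite -mulrBl ler_pdivlMr// mulrC hD// ltnW.
  lra.
apply: (@le_lt_trans _ _ (T M.+1 + P M.+1 / kappa)%:E); last exact: ltry.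
apply: lime_le; first by apply: is_cvg_nneseries => k _ _; rewrite lee_fin.
exists M.+1 => // n /= Mn; rewrite sumEFin lee_fin.
apply: le_trans (hT n Mn); rewrite lerDl divr_ge0 ?(ltW k0)// P0//.
exact: ltnW.
Qed.

End Sequences.

(** * Analysis of a run of the algorithm *)

Section Run.
Context {R : realType} {m n : nat}.
Variables (A : 'M[R]_(m, n)) (f : 'cV[R]_m -> R) (lambda q : R).
Variables (tau alpha mu_min mu_max sigma varrho beta b1 b2 : R).
Variables (x xb d : nat -> 'cV[R]_n) (mu mub : nat -> R).
Hypotheses (f_C2 : twice_continuously_differentiable f).
Hypothesis f_bounded_below : (-oo < ereal_inf [set (f z)%:E | z in [set: 'cV[R]_m]])%E.
Hypotheses (lambda_gt0 : 0 < lambda) (q_gt0_lt1 : 0 < q < 1).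
Hypotheses (tau_gt1 : 1 < tau) (alpha_gt0 : 0 < alpha) (mu_min_gt0 : 0 < mu_min).
Hypotheses (sigma_gt0 : 0 < sigma) (varrho_bounds : 0 < varrho < 1 / 2).
Hypotheses (beta_bounds : 0 < beta < 1) (b1_gt0 : 0 < b1) (b2_gt0 : 0 < b2).
Hypothesis run : hpgsrn_run f lambda q A tau alpha mu_min mu_max sigma varrho beta
           b1 b2 0 x xb d mu mub.
Hypothesis angle : (0 < limf_einf
                  (fun k => (descent_cosine f lambda q A (x k) (d k))%:E)
                  (within (K2 lambda q x xb mub) \oo))%E.

Let q_gt0 : 0 < q. Proof. by case/andP: q_gt0_lt1. Qed.
Let q_lt1 : q < 1. Proof. by case/andP: q_gt0_lt1. Qed.

Local Notation obj := (F f lambda q A).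
Local Notation g := (free_grad f A lambda q).
Local Notation newton k := (newton_test lambda q (x k) (xb k) (mub k)).

Lemma angle_lower_bound : exists c N, 0 < c /\ forall k, (N <= k)%N -> newton k ->
  c <= descent_cosine f lambda q A (x k) (d k).
Proof.
move: angle; rewrite limf_einfE => /ereal_sup_gt[_ [V [N _ NV] <-]] h.
(* An infimum of +oo means that V is empty, and then any positive c will do. *)
have [c c0 hc] : exists2 c : R, 0 < c &
    (c%:E <= ereal_inf [set (descent_cosine f lambda q A (x k) (d k))%:E | k in V])%E.
  move: h; case: (ereal_inf _) => [r|_|//]; last by exists 1; rewrite // leey.
  by rewrite lte_fin => r0; exists r.
exists c, N; split=> // k Nk tk; rewrite -lee_fin; apply: le_trans hc _.
by apply: ereal_inf_lbound; exists k => //; exact: NV.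
Qed.

Lemma f_lower_bound : exists cf : R, forall z : 'cV[R]_m, cf <= f z.
Proof.
have lb z : (ereal_inf [set (f z)%:E | z in [set: 'cV[R]_m]] <= (f z)%:E)%E.
  by apply: ereal_inf_lbound; exists z.
move: f_bounded_below lb; case: (ereal_inf _) => [r _|_ /(_ 0)|//].
  by move=> lb; exists r => z; rewrite -lee_fin; exact: lb.
by rewrite leye_eq.
Qed.

Lemma proximal_facts k : [/\ 0 < mub k, mu_min <= mub k,
  prox_grad f lambda q A (mub k) (x k) (xb k)
  & obj (xb k) <= obj (x k) - alpha / 2 * enorm (xb k - x k) ^+ 2].
Proof.
have [/andP[mk _] [l [y [yP _ acc [xbE mubE]]]] _ _] := run k.
have mub_ge : mu_min <= mub k.
  have mu0 : 0 <= mu k := le_trans (ltW mu_min_gt0) mk.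
  by rewrite mubE; apply: le_trans mk _; rewrite ler_peMl// exprn_ege1// ltW.
split=> //; first exact: lt_le_trans mub_ge.
- by rewrite mubE xbE; exact: yP.
- by rewrite xbE.
Qed.

Lemma run_facts : exists r nu M kappa kappa0 a b N,
  [/\ 0 < nu, 0 < M, 0 < kappa, 0 < kappa0 & 0 < a /\ 0 < b] /\
  forall k, (N <= k)%N ->
  [/\ [/\ `|x k| <= r, obj (x k.+1) <= obj (x k), mub k <= M
        & forall i, xb k i 0 != 0 -> nu <= `|xb k i 0|],
      newton k ->
        [/\ forall i, kappa0 * `|x k i 0 - xb k i 0| <= `|g (x k) i 0|,
            obj (x k.+1) <= obj (x k)
              - kappa * enorm (g (x k)) * enorm (x k.+1 - x k),
            Num.min a (b * enorm (g (x k))) <= enorm (x k.+1 - x k),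
            0 < enorm (g (x k)) /\ 0 < enorm (x k.+1 - x k)
          & forall i, x k i 0 = 0 -> x k.+1 i 0 = 0]
    & ~~ newton k -> x k.+1 = xb k].
Proof.
have [c [N [c0 hcos]]] := angle_lower_bound.
have [cf hcf] := f_lower_bound.
have [r r0 hr] := F_level_bounded A lambda_gt0 q_gt0_lt1 (obj (x N)) hcf.
have [M0 hM0] := prox_step_bounded A f_C2 lambda_gt0 q_gt0_lt1 mu_max r mu_min_gt0 tau_gt1 alpha_gt0.
pose M := Num.max M0 1.
have M_gt0 : 0 < M by rewrite lt_max ltr01 orbT.
have l0 : 0 < lambda * q * (1 - q) by rewrite !mulr_gt0// subr_gt0.
have cM0 : 0 < M / (lambda * q * (1 - q)) by rewrite divr_gt0.
(* The entry size at which the penalty curvature lambda q (1 - q) t^(q-2) equals M. *)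
pose nu := (M / (lambda * q * (1 - q))) `^ (q - 2)^-1.
have nu0 : 0 < nu by rewrite powR_gt0.
have q2 : q - 2 < 0 by have := q_lt1; lra.
have nuP (t : R) : t != 0 -> lambda * q * (1 - q) * `|t| `^ (q - 2) <= M -> nu <= `|t|.
  move=> t0 h; apply: npowR_le_lower_bound => //; first by rewrite normr_gt0.
  by rewrite ler_pdivlMr// mulrC.
have [a [b [a0 b0 hN]]] := @newton_step_bound _ _ _ f A lambda q f_C2 lambda_gt0
  q_gt0_lt1 r nu sigma varrho beta b1 b2 c r0 nu0 sigma_gt0 varrho_bounds beta_bounds b1_gt0 b2_gt0 c0.
have vr0 : 0 < varrho by case/andP: varrho_bounds.
exists r, nu, M, (varrho * c), (mu_min * (1 - q / 2) / 2), a, b, N.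
split; first by split=> //; [exact: mulr_gt0|rewrite !mulr_gt0//; have := q_lt1; lra].
(* All facts at k follow from membership of x_k in the level set of x_N; as they include the
   decrease at k, membership propagates by induction. *)
have main k : (N <= k)%N -> obj (x k) <= obj (x N) ->
  [/\ [/\ `|x k| <= r, obj (x k.+1) <= obj (x k), mub k <= M
        & forall i, xb k i 0 != 0 -> nu <= `|xb k i 0|],
      newton k ->
        [/\ forall i, mu_min * (1 - q / 2) / 2 * `|x k i 0 - xb k i 0| <= `|g (x k) i 0|,
            obj (x k.+1) <= obj (x k)
              - varrho * c * enorm (g (x k)) * enorm (x k.+1 - x k),
            Num.min a (b * enorm (g (x k))) <= enorm (x k.+1 - x k),
            0 < enorm (g (x k)) /\ 0 < enorm (x k.+1 - x k)
          & forall i, x k i 0 = 0 -> x k.+1 i 0 = 0]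
    & ~~ newton k -> x k.+1 = xb k].
  move=> Nk Fk; have xr := hr _ Fk.
  have [mb0 mmb pg dec] := proximal_facts k.
  have [mk ps _ st] := run k.
  have mbM : mub k <= M by rewrite le_max (hM0 _ _ _ _ xr mk ps).
  have xbnu i : xb k i 0 != 0 -> nu <= `|xb k i 0|.
    move=> xi; apply: nuP => //.
    have h := prox_grad_curvature_coord lambda_gt0 q_gt0_lt1 mb0 pg xi.
    have h2 := ler_wpM2l (ltW q_gt0) h.
    have h3 : q * (mub k / 2) <= mub k.
      have : q * mub k <= mub k by rewrite ler_piMl// ltW.
      lra.
    by move: h2 h3; set P := _ `^ _; lra.
  have nt : newton k ->
          [/\ forall i, mu_min * (1 - q / 2) / 2 * `|x k i 0 - xb k i 0| <= `|g (x k) i 0|,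
              obj (x k.+1) <= obj (x k)
                - varrho * c * enorm (g (x k)) * enorm (x k.+1 - x k),
              Num.min a (b * enorm (g (x k))) <= enorm (x k.+1 - x k),
              0 < enorm (g (x k)) /\ 0 < enorm (x k.+1 - x k)
            & forall i, x k i 0 = 0 -> x k.+1 i 0 = 0].
    move=> tk; rewrite tk in st.
    have xnu i : x k i 0 != 0 -> nu <= `|x k i 0|.
      move=> xi; apply: nuP => //; apply: le_trans mbM.
      exact: newton_test_lower lambda_gt0 q_gt0_lt1 _ _ _ _ mb0 pg tk xi.
    have [h1 h2 h3 h4 h5] := hN _ _ _ xr xnu st (hcos k Nk tk).
    split=> // i.
    apply: le_trans (newton_test_step_le lambda_gt0 q_gt0_lt1 i mb0 pg tk).
    rewrite ler_wpM2r// ler_pM2r ?invr_gt0// ler_wpM2r//.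
    by have := q_lt1; lra.
  have nnt : ~~ newton k -> x k.+1 = xb k by move=> /negPf tk; rewrite tk in st.
  split=> //; split=> //.
  have [/nt[_ h _ _ _]|/nnt ->] := boolP (newton k).
    apply: le_trans h _; rewrite gerBl !mulr_ge0 ?enorm_ge0 ?(ltW vr0)// ltW//.
  by apply: le_trans dec _; rewrite gerBl mulr_ge0 ?sqr_ge0// divr_ge0// ltW.
move=> k Nk; apply: (main k Nk).
elim: k Nk => [|k IH]; first by rewrite leqn0 => /eqP ->.
rewrite leq_eqVlt => /predU1P[->//|Nk].
by have [[_ h _ _] _ _] := main k Nk (IH Nk); exact: le_trans h (IH Nk).
Qed.

Lemma run_eventually_newton : exists r M kappa a b l N,
  [/\ 0 < M, 0 < kappa, 0 < a & 0 < b] /\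
  [/\ forall k, (N <= k)%N ->
        [/\ `|x k| <= r, mub k <= M,
            obj (x k.+1) <= obj (x k) - kappa * enorm (g (x k)) * enorm (x k.+1 - x k),
            Num.min a (b * enorm (g (x k))) <= enorm (x k.+1 - x k)
          & l < obj (x k)],
      forall e, 0 < e -> exists K, forall k, (K <= k)%N -> obj (x k) < l + e,
      forall e, 0 < e -> exists K, forall k, (K <= k)%N -> `|x k - xb k| <= e
    & forall e, 0 < e -> exists K, forall k, (K <= k)%N -> enorm (g (x k)) <= e].
Proof.
have [r [nu [M [kappa [kappa0 [a [b [N [[nu0 M0 ka0 kb0 [a0 b0]] hk]]]]]]]]] := run_facts.
have [cf hcf] := f_lower_bound.
have lbF k : cf <= obj (x k).
  apply: le_trans (hcf (A *m x k)) _; rewrite /F /psi lerDl.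
  by rewrite mulr_ge0 ?lq_ge0// ltW.
have mono k : (N <= k)%N -> obj (x k.+1) <= obj (x k) by move=> /hk[[]].
have [l lF Fl] := eventually_nonincreasing_cvg mono lbF.
have small e : 0 < e -> exists2 K, (N <= K)%N & forall k, (K <= k)%N ->
    obj (x k) - obj (x k.+1) < e.
  move=> e0; have [K hK] := Fl e e0; exists (maxn N K); first exact: leq_maxl.
  move=> k; rewrite geq_max => /andP[Nk Kk].
  have := hK k Kk; have := lF k.+1 (leq_trans Nk (leqnSn k)); lra.
have gsmall e : 0 < e -> exists2 K, (N <= K)%N & forall k, (K <= k)%N -> newton k ->
    enorm (g (x k)) <= e.
  (* The least decrease that a Newton step would produce if its residual exceeded e. *)
  move=> e0; have dl : 0 < kappa * e * Num.min a (b * e).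
    by rewrite !mulr_gt0// lt_min a0 mulr_gt0.
  have [K NK hK] := small _ dl; exists K => // k Kk tk.
  have [_ /(_ tk)[_ h1 h2 _ _] _] := hk k (leq_trans NK Kk).
  rewrite leNgt; apply/negP => ge.
  have h3 : kappa * e * Num.min a (b * e) <= kappa * enorm (g (x k)) * enorm (x k.+1 - x k).
    apply: ler_pM.
    - by rewrite mulr_ge0 ?(ltW ka0) ?(ltW e0).
    - by rewrite le_min (ltW a0) mulr_ge0 ?(ltW b0) ?(ltW e0).
    - by rewrite ler_pM2l// ltW.
    apply: le_trans h2; rewrite le_min !ge_min lexx /=.
    by rewrite ler_pM2l// (ltW ge) !orbT.
  have := hK k Kk; lra.
(* At Newton iterations the residual controls x_k - xb_k; at the others x_(k+1) = xb_k and the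
   acceptance test of the proximal step does. *)
have xbsmall e : 0 < e -> exists2 K, (N <= K)%N & forall k, (K <= k)%N -> `|x k - xb k| <= e.
  move=> e0; have [K1 NK1 hK1] := gsmall _ (mulr_gt0 kb0 e0).
  have al : 0 < alpha / 2 * e ^+ 2 by rewrite mulr_gt0 ?divr_gt0// exprn_gt0.
  have [K2 NK2 hK2] := small _ al.
  exists (maxn K1 K2); first by rewrite leq_max NK1.
  move=> k; rewrite geq_max => /andP[k1 k2].
  have [_ h1 h2] := hk k (leq_trans NK1 k1).
  have [tk|tk] := boolP (newton k).
    have [h3 _ _ _ _] := h1 tk; have h4 := hK1 k k1 tk.
    apply: norm_le_coord => [|i]; first exact: ltW.
    rewrite !mxE -(ler_pM2l kb0); apply: le_trans (h3 i) _.
    by apply: le_trans (coord_le_norm _ _ _) (le_trans (norm_le_enorm _) h4).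
  have [_ _ _ dec] := proximal_facts k; have := hK2 k k2; rewrite (h2 tk) => lt.
  have h3 : enorm (xb k - x k) ^+ 2 <= e ^+ 2.
    rewrite -(@ler_pM2l _ (alpha / 2)) ?divr_gt0//; lra.
  rewrite distrC; apply: le_trans (norm_le_enorm _) _.
  by rewrite -(@ler_pXn2r _ 2) ?nnegrE ?enorm_ge0 ?(ltW e0).
(* Nonzero entries of xb_k have size at least nu, so a deviation of nu/20 changes no sign and is
   within the 1/10 tolerance of [newton_test_close]. *)
have nu20 : 0 < nu / 20 by rewrite divr_gt0.
have [K NK hK] := xbsmall _ nu20.
have nuK k : (K <= k)%N -> forall i, xb k i 0 != 0 -> nu <= `|xb k i 0|.
  by move=> Kk; have [[_ _ _ h] _ _] := hk k (leq_trans NK Kk).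
have close k i : (K <= k)%N -> `|x k i 0 - xb k i 0| <= nu / 20.
  by move=> Kk; apply: le_trans (hK k Kk); have := coord_le_norm (x k - xb k) i 0; rewrite !mxE.
have sub1 k : (K <= k)%N -> supp (xb k) \subset supp (x k).
  move=> Kk; apply/fintype.subsetP => i; rewrite !in_supp => xi.
  have h1 := nuK k Kk i xi; have h2 := close k i Kk.
  by apply/eqP => x0; move: h2; rewrite x0 sub0r normrN; lra.
have sub2 k : (K <= k)%N -> supp (x k.+1) \subset supp (xb k).
  move=> Kk; have [_ h1 h2] := hk k (leq_trans NK Kk).
  have [tk|/h2 ->//] := boolP (newton k).
  have [_ _ _ _ h3] := h1 tk; case/andP: tk => /eqP sgn _.
  apply/fintype.subsetP => i; rewrite !in_supp -(sign_eq_neq0 i sgn).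
  by apply: contraNN => /eqP /h3 ->.
have [K' hK'] : exists K', forall k, (K' <= k)%N -> #|supp (x k.+1)| = #|supp (x k)|.
  apply: (@nat_nonincreasing_eventually_constant (fun k => #|supp (x k)|) K) => k Kk.
  exact: subset_leq_card (fintype.subset_trans (sub2 k Kk) (sub1 k Kk)).
have newt k : (maxn K K' <= k)%N -> newton k.
  rewrite geq_max => /andP[Kk K'k].
  have [mb0 _ pg _] := proximal_facts k.
  (* The support of xb_k lies between those of x_(k+1) and x_k, which have equal cardinality. *)
  have s3 : supp (xb k) = supp (x k).
    apply/eqP; rewrite eqEcard sub1//= -(hK' k K'k).
    exact: subset_leq_card (sub2 k Kk).
  have zer i : (xb k i 0 == 0) = (x k i 0 == 0).
    by apply: negb_inj; rewrite -!in_supp s3.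
  apply: (newton_test_close lambda_gt0 q_gt0_lt1 mb0 pg) => [|i].
    apply/colP => i; rewrite !mxE; have [x0|xi] := eqVneq (xb k i 0) 0.
      by have := zer i; rewrite x0 eqxx => /esym/eqP ->.
    have h1 := nuK k Kk i xi; have := close k i Kk; rewrite ler_norml => /andP[h2 h3].
    have [p|p|/eqP] := ltrgt0P (xb k i 0); last by rewrite (negPf xi).
      by move: h1; rewrite (gtr0_norm p) => h1; rewrite !gtr0_sg//; lra.
    by move: h1; rewrite (ltr0_norm p) => h1; rewrite !ltr0_sg//; lra.
  have [x0|xi] := eqVneq (xb k i 0) 0.
    have := zer i; rewrite x0 eqxx => /esym/eqP ->.
    by rewrite subrr !normr0 mul0r.
  have := nuK k Kk i xi; have := close k i Kk; lra.
exists r, M, kappa, a, b, l, (maxn K K'); split=> //; split.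
- move=> k kk; have tk := newt k kk.
  have Nk : (N <= k)%N by apply: leq_trans NK _; apply: leq_trans kk; exact: leq_maxl.
  have [[h1 h2 h3 _] /(_ tk)[_ h4 h5 [h6 h7] _] _] := hk k Nk.
  split=> //; apply: le_lt_trans (lF k.+1 (leq_trans Nk (leqnSn k))) _.
  apply: le_lt_trans h4 _; rewrite ltrBlDr ltrDl !mulr_gt0//.
- exact: Fl.
- by move=> e /xbsmall[K1 _ h]; exists K1.
- move=> e /gsmall[K1 _ h]; exists (maxn K1 (maxn K K')) => k.
  by rewrite geq_max => /andP[/h h1 /newt].
Qed.

Lemma run_cluster_point (r : R) (N : nat) : (forall k, (N <= k)%N -> `|x k| <= r) ->
  exists xs : 'cV[R]_n, forall e K, 0 < e -> exists2 k, (K <= k)%N & `|x k - xs| < e.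
Proof.
move=> hr.
have [xs [_ cl]] : [set v : 'cV[R]_n | `|v| <= r] `&` cluster (x @ \oo) !=set0.
  by apply: cball_compact; exists N => // k /= /hr.
exists xs => e K e0.
have FA : (x @ \oo) [set x k | k in [set k | (K <= k)%N]].
  by exists K => // k /= Kk; exists k.
have nB : nbhs xs (ball xs e) by exact: nbhsx_ballx.
have [_ [[k /= Kk <-]]] := cl _ _ FA nB.
by rewrite -ball_normE /= distrC => xe; exists k.
Qed.

(** The bound M itself serves as the stationarity parameter: in the prox inequality the nonnegative
    quadratic term at xb_k is dropped and mub_k is raised to M on the side of w, so the parameters
    need not converge. *)
Lemma run_limit_stationary (M : R) (N : nat) (xs : 'cV[R]_n) : 0 < M ->
  (forall k, (N <= k)%N -> mub k <= M) ->
  (forall e, 0 < e -> exists K, forall k, (K <= k)%N -> `|x k - xb k| <= e) ->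
  x @ \oo --> xs -> L_stationary f lambda q A xs.
Proof.
move=> M0 hM hxb xxs; exists M => //; apply/(prox_gradP _ _ _ _ _ _ M0) => w.
have xbxs : xb @ \oo --> xs.
  apply/cvgrPdist_le => e e0; have e2 : 0 < e / 2 by rewrite divr_gt0.
  have [K hK] := hxb _ e2.
  move/cvgrPdist_le : xxs => /(_ _ e2)[K2 _ hK2].
  exists (maxn K K2) => // k /=; rewrite geq_max => /andP[/hK h1 /hK2 h2].
  by have := ler_distD (x k) xs (xb k); move: h1 h2 => /= h1 h2; lra.
have gx : (fun k => grad (psi f A) (x k)) @ \oo --> grad (psi f A) xs.
  by apply: (cvg_comp x (grad (psi f A)) xxs); exact: continuous_grad_psi.
have lqxb : (fun k => lq q (xb k)) @ \oo --> lq q xs.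
  by apply: (cvg_comp xb (@lq R q n) xbxs); exact: continuous_lq.
have wx : (fun k => w - x k) @ \oo --> w - xs by apply: cvgB => //; exact: cvg_cst.
have xbx : (fun k => xb k - x k) @ \oo --> xs - xs by exact: cvgB.
have L1 : (fun k => dot (grad (psi f A) (x k)) (xb k - x k) + lambda * lq q (xb k)) @ \oo -->
    dot (grad (psi f A) xs) (xs - xs) + lambda * lq q xs.
  by apply: cvgD; [exact: cvg_dot|apply: cvgM; [exact: cvg_cst|exact: lqxb]].
have L2 : (fun k => M / 2 * dot (w - x k) (w - x k) + dot (grad (psi f A) (x k)) (w - x k)
      + lambda * lq q w) @ \oo -->
    M / 2 * dot (w - xs) (w - xs) + dot (grad (psi f A) xs) (w - xs) + lambda * lq q w.
  apply: cvgD; last exact: cvg_cst.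
  by apply: cvgD; [apply: cvgM; [exact: cvg_cst|exact: cvg_dot]|exact: cvg_dot].
have -> : enorm (xs - xs) ^+ 2 = 0 by rewrite subrr enorm0 expr0n.
rewrite enorm_sqr.
suff : dot (grad (psi f A) xs) (xs - xs) + lambda * lq q xs <=
    M / 2 * dot (w - xs) (w - xs) + dot (grad (psi f A) xs) (w - xs) + lambda * lq q w by lra.
apply: ler_cvg_to L1 L2 _; exists N => // k /= Nk.
have [mb0 _ /(prox_gradP _ _ _ _ _ _ mb0)/(_ w) pg _] := proximal_facts k.
have h1 : 0 <= mub k / 2 * enorm (xb k - x k) ^+ 2.
  by rewrite mulr_ge0 ?sqr_ge0// divr_ge0// ltW.
have h2 : mub k / 2 * enorm (w - x k) ^+ 2 <= M / 2 * dot (w - x k) (w - x k).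
  by rewrite enorm_sqr ler_wpM2r ?dot_ge0// ler_pM2r ?hM// invr_gt0.
lra.
Qed.

Lemma run_convergence : KL_function (EFin \o obj) ->
  (\sum_(1 <= k <oo) (enorm (x k.+1 - x k))%:E < +oo)%E /\
  exists xs : 'cV[R]_n,
    [/\ x @ \oo --> xs, L_stationary f lambda q A xs
      & KL_exponent_half_at (EFin \o obj) xs -> r_linear_cvg x xs].
Proof.
move=> KL.
have [r [M [kappa [a [b [l [N [[M0 ka0 a0 b0] [hk Fl hxb hg]]]]]]]]] := run_eventually_newton.
have [|xs cl] := @run_cluster_point r N; first by move=> k /hk[].
(* Continuity of the objective identifies the limit value with the value at the cluster point. *)
have Fxs : obj xs = l.
  apply/eqP; rewrite -subr_eq0 -normr_le0; apply/ler_addgt0Pr => e e0; rewrite add0r.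
  have e2 : 0 < e / 2 by rewrite divr_gt0.
  have /nbhs_ballP[dl /= d0 hd] : nbhs xs [set y | `|obj xs - obj y| < e / 2].
    move/cvgrPdist_lt : (@continuous_F _ _ _ f A lambda q f_C2 q_gt0_lt1 xs) => /(_ _ e2).
    exact.
  have [K hK] := Fl _ e2; have [k kk xk] := cl dl (maxn N K) d0.
  move: kk; rewrite geq_max => /andP[/hk[_ _ _ _ h1] /hK h2].
  have := hd (x k); rewrite -ball_normE /= distrC => /(_ xk) h3.
  have := ler_distD (obj (x k)) (obj xs) l.
  have : `|obj (x k) - l| < e / 2 by rewrite ger0_norm; lra.
  lra.
have hgt k : (N <= k)%N -> obj xs < obj (x k) by rewrite Fxs => /hk[].
have hlim e : 0 < e -> exists K, forall k, (K <= k)%N -> obj (x k) < obj xs + e.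
  by rewrite Fxs; exact: Fl.
have hdec k : (N <= k)%N ->
    obj (x k.+1) <= obj (x k) - kappa * enorm (g (x k)) * enorm (x k.+1 - x k).
  by move=> /hk[].
have hsub := @free_grad_limiting_subdiff _ _ _ f A lambda q f_C2 lambda_gt0 q_gt0_lt1.
have [phi hphi] : KL_at (EFin \o obj) xs by apply: KL; exists (g xs); exact: hsub.
have [xxs [K hK]] := kl_descent ka0 hsub hphi hdec hgt hlim cl.
split.
  apply: (@nneseries_lty_telescope _ _ (fun k => phi (obj (x k) - obj xs)) K kappa) => //.
  - by move=> k; exact: enorm_ge0.
  - by move=> k /hK[].
  - by move=> k /hK[].
exists xs; split=> //.
  by apply: (@run_limit_stationary M N) => // k /hk[].
move=> [c c0 hc].
have [_ [K1 hK1]] := kl_descent ka0 hsub hc hdec hgt hlim cl.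
(* Once the residual is at most a / b, the minimum of a and b times the residual is the latter. *)
have [K2 hK2] := hg (a / b) (divr_gt0 a0 b0).
pose e k := obj (x k) - obj xs.
pose K3 := maxn N (maxn K1 K2).
have K3P k : (K3 <= k)%N -> [/\ (N <= k)%N, (K1 <= k)%N & (K2 <= k)%N].
  by rewrite !geq_max => /and3P.
have e0 k : (K3 <= k)%N -> 0 < e k by move=> /K3P[/hgt h _ _]; rewrite subr_gt0.
(* For phi = c sqrt, KL reads (2/c)^2 e_k <= |r_k|^2, while the decrease is now at least kappa b
   |r_k|^2. *)
pose th := kappa * b * (2 / c) ^+ 2.
have th0 : 0 < th.
  by apply: mulr_gt0; [exact: mulr_gt0|rewrite exprn_gt0// divr_gt0].
have edec k : (K3 <= k)%N -> e k.+1 <= (1 - th) * e k.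
  move=> /[dup] /e0 ek0 /K3P[Nk k1 k2].
  have [_ _ _ h1] := hK1 k k1; have [_ _ h2 h3 _] := hk k Nk.
  set G := enorm (g (x k)) in h1 h2 h3.
  have sq0 : 0 < Num.sqrt (e k) by rewrite sqrtr_gt0.
  have h4 : 2 / c * Num.sqrt (e k) <= G.
    move: h1; rewrite derive1_scaled_sqrt// -/(e k) => h1.
    have -> : 2 / c * Num.sqrt (e k) = 1 * (2 / c * Num.sqrt (e k)) by rewrite mul1r.
    have p : 0 < 2 / c * Num.sqrt (e k) by rewrite mulr_gt0// divr_gt0.
    have := ler_wpM2r (ltW p) h1.
    have -> : c / (2 * Num.sqrt (e k)) * G * (2 / c * Num.sqrt (e k)) = G.
      by field; rewrite !gt_eqF.
    by [].
  have h5 : b * G <= enorm (x k.+1 - x k).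
    apply: le_trans h3; rewrite le_min lexx andbT.
    by have := hK2 k k2; rewrite ler_pdivlMr// mulrC.
  have h6 : (2 / c) ^+ 2 * e k <= G ^+ 2.
    have G0 : 0 <= G by exact: enorm_ge0.
    have s0 : 0 <= 2 / c * Num.sqrt (e k) by rewrite mulr_ge0 ?divr_ge0// ltW.
    have : (2 / c * Num.sqrt (e k)) ^+ 2 <= G ^+ 2 by rewrite ler_pXn2r ?nnegrE.
    by rewrite exprMn sqr_sqrtr// ltW.
  have h7 : kappa * G * (b * G) <= kappa * G * enorm (x k.+1 - x k).
    by rewrite ler_wpM2l// mulr_ge0 ?enorm_ge0// ltW.
  have h8 : kappa * b * ((2 / c) ^+ 2 * e k) <= kappa * b * G ^+ 2.
    by rewrite ler_pM2l// mulr_gt0.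
  have h9 : kappa * G * (b * G) = kappa * b * G ^+ 2 by ring.
  have h10 : (1 - th) * e k = e k - kappa * b * ((2 / c) ^+ 2 * e k) by rewrite /th; ring.
  rewrite h10 /e; rewrite /e in h8; lra.
(* The contraction factor is positive because the values e_k stay positive. *)
have th1 : 0 < 1 - th.
  have := edec K3 (leqnn _); have := e0 _ (leqnSn K3); have := e0 _ (leqnn K3) => p1 p2 p3.
  by rewrite -(pmulr_lgt0 _ p1); exact: lt_le_trans p2 p3.
(* The distance to xs is at most phi(e_k) / kappa, a multiple of the square root of e_k, hence the
   square root of the factor. *)
pose rho := Num.sqrt (1 - th).
have rho0 : 0 < rho by rewrite sqrtr_gt0.
have rho2 : rho ^+ 2 = 1 - th by rewrite sqr_sqrtr// ltW.
have rho1 : rho < 1.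
  rewrite -(@ltr_pXn2r _ 2) ?nnegrE ?(ltW rho0)// rho2 expr1n; lra.
have egeo j : e (K3 + j)%N <= rho ^+ (2 * j) * e K3.
  elim: j => [|j IH]; first by rewrite addn0 muln0 expr0 mul1r.
  rewrite addnS; apply: le_trans (edec _ (leq_addr _ _)) _.
  rewrite mulnS exprD rho2 -mulrA ler_pM2l//.
have dist k : (K3 <= k)%N -> enorm (x k - xs) <=
    n%:R * (c * Num.sqrt (e K3) / kappa) / rho ^+ K3 * rho ^+ k.
  move=> kk; have [_ k1 _] := K3P k kk; have [_ _ h1 _] := hK1 k k1.
  apply: le_trans (enorm_le_norm _) _.
  have rk : rho ^+ K3 != 0 by rewrite gt_eqF// exprn_gt0.
  have -> : n%:R * (c * Num.sqrt (e K3) / kappa) / rho ^+ K3 * rho ^+ k =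
     n%:R * (c * (rho ^+ (k - K3) * Num.sqrt (e K3)) / kappa).
    rewrite -[in rho ^+ k](subnK kk) exprD; field.
    by rewrite rk gt_eqF.
  rewrite ler_wpM2l//; apply: le_trans h1 _; rewrite -/(e k).
  rewrite ler_pM2r ?invr_gt0// ler_pM2l//.
  have ek : e k <= rho ^+ (2 * (k - K3)) * e K3 by have := egeo (k - K3)%N; rewrite subnKC.
  apply: le_trans (ler_wsqrtr ek) _.
  have rj : 0 <= rho ^+ (k - K3) by rewrite exprn_ge0// ltW.
  rewrite mulnC exprM sqrtrM ?sqr_ge0// sqrtr_sqr ger0_norm//.
have [C C0 hC] := @geometric_bound_from _ (fun k => enorm (x k - xs)) K3
  (n%:R * (c * Num.sqrt (e K3) / kappa) / rho ^+ K3) rho rho0 ltac:(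
    by rewrite divr_ge0 ?exprn_ge0 ?(ltW rho0)// mulr_ge0// divr_ge0 ?(ltW ka0)// mulr_ge0 ?sqrtr_ge0// ltW)
  (fun k => enorm_ge0 _) dist.
by exists C, rho; split=> //; rewrite rho0.
Qed.

End Run.

Theorem theorem4p7 (R : realType) (m n : nat) (A : 'M[R]_(m, n))
  (f : 'cV[R]_m -> R) (lambda q : R)
  (tau alpha mu_min mu_max sigma varrho beta b1 b2 : R)
  (x xb d : nat -> 'cV[R]_n) (mu mub : nat -> R)
  (f_C2 : twice_continuously_differentiable f)
  (f_bounded_below : (-oo < ereal_inf [set (f z)%:E | z in [set: 'cV[R]_m]])%E)
  (lambda_gt0 : 0 < lambda) (q_gt0_lt1 : 0 < q < 1)
  (tau_gt1 : 1 < tau) (alpha_gt0 : 0 < alpha)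
  (mu_min_gt0 : 0 < mu_min) (mu_min_lt_max : mu_min < mu_max)
  (sigma_bounds : 0 < sigma <= 1 / 2) (varrho_bounds : 0 < varrho < 1 / 2)
  (beta_bounds : 0 < beta < 1) (b1_gt1 : 1 < b1) (b2_gt0 : 0 < b2)
  (run : hpgsrn_run f lambda q A tau alpha mu_min mu_max sigma varrho beta
           b1 b2 0 x xb d mu mub)
  (hess_f_lipschitz : locally_lipschitz (hess f))
  (angle : (0 < limf_einf
                  (fun k => (descent_cosine f lambda q A (x k) (d k))%:E)
                  (within (K2 lambda q x xb mub) \oo))%E) :
  KL_function (EFin \o F f lambda q A) ->
  (\sum_(1 <= k <oo) (enorm (x k.+1 - x k))%:E < +oo)%E /\
  exists xs : 'cV[R]_n,
    [/\ x @ \oo --> xs,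
        L_stationary f lambda q A xs
      & KL_exponent_half_at (EFin \o F f lambda q A) xs ->
        r_linear_cvg x xs].
Proof.
apply: (run_convergence f_C2 f_bounded_below lambda_gt0 q_gt0_lt1 tau_gt1 alpha_gt0
  mu_min_gt0 _ varrho_bounds beta_bounds _ b2_gt0 run angle).
- by case/andP: sigma_bounds.
- exact: lt_trans ltr01 b1_gt1.
Qed.
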